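(* Let $d\in\mathbb N$, $d\ge 1$, let $0\le p\le d$ and $q=d-p$, and let $f\in\mathcal G(\mathbb R^d)$. Then $f$ is invariant under $O(p,q,\mathbb R)$ (i.e. $f\circ A=f$ in $\mathcal G(\mathbb R^d)$ for all $A\in O(p,q,\mathbb R)$) if and only if $f$ is invariant under $O(p,q,\widetilde{\mathbb R}_c)$ (i.e. $f\circ A=f$ in $\mathcal G(\mathbb R^d)$ for all $A\in O(p,q,\widetilde{\mathbb R}_c)$).
   Context: The special Colombeau algebra: let $\mathcal E(\mathbb R^d)$ be the algebra of all nets $(u_\varepsilon)_{\varepsilon\in(0,1)}$ of $\mathcal C^\infty$-functions $\mathbb R^d\to\mathbb C$. Let $\mathcal E_M(\mathbb R^d)$ be the set of $(u_\varepsilon)_\varepsilon\in\mathcal E(\mathbb R^d)$ such that for every compact $K\subset\mathbb R^d$ and every multi-index $\alpha\in\mathbb N^d$ there exists $b\in\mathbb R$ with $\sup_{x\in K}|\partial^\alpha u_\varepsilon(x)|=O(\varepsilon^b)$ as $\varepsilon\to0$. Let $\mathcal N(\mathbb R^d)$ be the set of those $(u_\varepsilon)_\varepsilon\in\mathcal E(\mathbb R^d)$ such that for every compact $K$, every $\alpha\in\mathbb N^d$ and every $b\in\mathbb R$, $\sup_{x\in K}|\partial^\alpha u_\varepsilon(x)|=O(\varepsilon^b)$ as $\varepsilon\to0$. Then $\mathcal G(\mathbb R^d)=\mathcal E_M(\mathbb R^d)/\mathcal N(\mathbb R^d)$. The ring $\widetilde{\mathbb R}_c$ of Colombeau generalized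 real numbers with bounded representative consists of the nets $(x_\varepsilon)_{\varepsilon\in(0,1)}$ of real numbers that are bounded for small $\varepsilon$, modulo the nets satisfying $|x_\varepsilon|=O(\varepsilon^b)$ as $\varepsilon\to0$ for every $b\in\mathbb R$. $\mathbb R$ is embedded in $\widetilde{\mathbb R}_c$ by constant nets. Let $B(x,y)=x_1y_1+\cdots+x_py_p-(x_{p+1}y_{p+1}+\cdots+x_dy_d)$. $O(p,q,\mathbb R)$ is the group of all linear transformations $A$ of $\mathbb R^d$ that leave $B$ invariant, i.e., in matrix notation, $A^tBA=B$; $O(p,q,\widetilde{\mathbb R}_c)$ is the group of all $d\times d$ matrices $A$ with entries in $\widetilde{\mathbb R}_c$ such that $A^tBA=B$. For a matrix $A$ over $\widetilde{\mathbb R}_c$ with (bounded) representative $(A_\varepsilon)_\varepsilon$, $f\circ A\in\mathcal G(\mathbb R^d)$ is the class of $(f_\varepsilon\circ A_\varepsilon)_\varepsilon$, where $(f_\varepsilon)_\varepsilon$ is a representative of $f$; this is well-defined. *)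

(* Defs.v *)
From HB Require Import structures.
From mathcomp Require Import all_boot all_order all_algebra.
From mathcomp Require Import all_classical all_reals all_analysis.
From mathcomp Require Import complex.

Set Implicit Arguments.
Unset Strict Implicit.
Unset Printing Implicit Defensive.

Import Order.TTheory GRing.Theory Num.Theory.
Import numFieldNormedType.Exports.

Local Open Scope classical_set_scope.
Local Open Scope ring_scope.
Local Open Scope quotient_scope.

(* [Rcomplex R] is [R[i]] seen as a vector space over [R], normed by the
   modulus; real-closed provides the norm, the induced topology is added here
   so that [differentiable] and ['D_v] apply to functions into it. *)
Section ComplexNormedModule.
Variable R : realType.

HB.instance Definition _ :=
  PseudoMetric.copy (Rcomplex R) (pseudoMetric_normed (Rcomplex R)).

HB.instance Definition _ := isPointed.Build (Rcomplex R) 0.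

HB.instance Definition _ :=
  NormedZmod_PseudoMetric_eq.Build R (Rcomplex R) erefl.

Lemma Rcomplex_normrZ (l : R) (z : Rcomplex R) : `|l *: z| = `|l| * `|z|.
Proof.
case: z => a b; rewrite /Num.norm/= /Normc.normc/=.
by rewrite !exprMn -mulrDr sqrtrM ?sqr_ge0// sqrtr_sqr.
Qed.

HB.instance Definition _ :=
  PseudoMetricNormedZmod_Lmodule_isNormedModule.Build R (Rcomplex R)
    Rcomplex_normrZ.

End ComplexNormedModule.

Section Asymptotics.
Variable R : realType.

Definition epsI := {e : R | 0 < e < 1}.
HB.instance Definition _ := [isSub of epsI for sval].
HB.instance Definition _ := [Choice of epsI by <:].

Lemma half_in01 : 0 < (2^-1 : R) < 1.
Proof. by rewrite invr_gt0 ltr0n invf_lt1 ?ltr0n// ltr1n. Qed.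

HB.instance Definition _ := isPointed.Build epsI 
  (exist (fun e : R => is_true (0 < e < 1)) _ half_in01).

(* [x_eps = O(eps ^ b)] as [eps --> 0], for nets of suprema, hence
   extended-real-valued (with [ereal_sup set0 = -oo]). *)
Definition bigO (x : epsI -> \bar R) (b : R) : Prop :=
  exists C e0 : R, 0 < e0 /\
    forall e : epsI, val e < e0 -> (x e <= (C * val e `^ b)%:E)%E.

Lemma bigO_le x y b : (forall e, (x e <= y e)%E) -> bigO y b -> bigO x b.
Proof.
move=> xy [C [e0 [e00 H]]]; exists C, e0; split=> // e ee0.
exact: le_trans (H _ ee0).
Qed.

Lemma bigO0 x b : (forall e, (x e <= 0)%E) -> bigO x b.
Proof.
by move=> x0; exists 0, 1; split => // e _; rewrite mul0r.
Qed.

Lemma bigOD x y b : bigO x b -> bigO y b -> bigO (fun e => x e + y e)%E b.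
Proof.
move=> [C [e0 [e00 H]]] [D [e1 [e10 K]]]; exists (C + D), (Num.min e0 e1).
split=> [|e]; first by rewrite lt_min e00.
rewrite lt_min => /andP[/H xC /K yD]; rewrite mulrDl EFinD.
exact: leeD.
Qed.

Lemma powR_le01 (e a b : R) : 0 < e < 1 -> b <= a -> e `^ a <= e `^ b.
Proof.
by move=> /andP[e0 e1] ba; rewrite ger_powR// e0 ltW.
Qed.

Lemma bigO_weak x a b : b <= a -> bigO x a -> bigO x b.
Proof.
move=> ba [C [e0 [e00 H]]]; exists `|C|, e0; split=> // e ee0.
apply: le_trans (H _ ee0) _; rewrite lee_fin.
rewrite (le_trans (ler_wpM2r (powR_ge0 _ _) (ler_norm C)))//.
by rewrite ler_wpM2l//; apply: powR_le01 ba; exact: (svalP e).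
Qed.

End Asymptotics.
Arguments bigO {R} x b.

Section GeneralizedReals.
Variable R : realType.
Local Notation epsI := (epsI R).

Definition bounded_net (x : epsI -> R) : Prop :=
  exists M e0 : R, 0 < e0 /\ forall e : epsI, val e < e0 -> `|x e| <= M.

Definition bounded_nets : {pred epsI -> R} := fun x => `[< bounded_net x >].

Lemma bounded_nets_subring_closed : subring_closed bounded_nets.
Proof.
split=> [|x y /asboolP[M [a [a0 xM]]] /asboolP[N [b [b0 yN]]]
         |x y /asboolP[M [a [a0 xM]]] /asboolP[N [b [b0 yN]]]]; apply/asboolP.
- by exists 1, 1; split=> // e _; rewrite normr1.
- exists (M + N), (Num.min a b); split=> [|e]; first by rewrite lt_min a0.
  rewrite lt_min => /andP[/xM ? /yN ?].
  by rewrite (le_trans (ler_normB _ _))// lerD.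
- exists (M * N), (Num.min a b); split=> [|e]; first by rewrite lt_min a0.
  by rewrite lt_min => /andP[/xM ? /yN ?]; rewrite normrM ler_pM.
Qed.

HB.instance Definition _ :=
  GRing.isSubringClosed.Build (epsI -> R) bounded_nets
    bounded_nets_subring_closed.

Record bnet := Bnet { bnet_val :> epsI -> R ; _ : bnet_val \in bounded_nets }.
HB.instance Definition _ := [isSub for bnet_val].
HB.instance Definition _ := [Choice of bnet by <:].
HB.instance Definition _ := [SubChoice_isSubComNzRing of bnet by <:].

Definition negligible_bnets : {pred bnet} :=
  fun x => `[< forall b : R, bigO (fun e => `|x e|%:E) b >].

Lemma negligible_bnets_ideal : idealr_closed negligible_bnets.
Proof.
split=> [||a x y /asboolP x0 /asboolP y0].
- by apply/asboolP => b; apply: bigO0 => e; rewrite normr0.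
- apply/asboolP => /(_ 1)[C [e0 [e00 H]]].
  pose e1 : R := Num.min (Num.min (e0 / 2) 2^-1) (`|C| + 2)^-1.
  have C2 : 0 < `|C| + 2 by rewrite ltr_wpDl.
  have e1P : 0 < e1 < 1.
    have /andP[h0 h1] := half_in01 R.
    rewrite !lt_min !gt_min h0 h1 divr_gt0// invr_gt0 C2/=.
    by rewrite !orbT.
  have := H (exist (fun e : R => is_true (0 < e < 1)) _ e1P); rewrite /= normr1 lee_fin powRr1; last first.
    by case/andP: e1P => /ltW.
  have -> : e1 < e0 by rewrite !gt_min ltr_pdivrMr// ltr_pMr// ltr1n.
  move=> /(_ isT); apply/negP; rewrite -ltNge.
  have e1C : e1 <= (`|C| + 2)^-1 by rewrite ge_min lexx orbT.
  apply: (@le_lt_trans _ _ (`|C| * (`|C| + 2)^-1)).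
    apply: (le_trans (ler_wpM2r _ (ler_norm C))).
      by case/andP: e1P => /ltW.
    by rewrite ler_wpM2l.
  by rewrite ltr_pdivrMr// mul1r ltrDl.
- apply/asboolP => b.
  have [M [e0 [e00 aM]]] := asboolW (valP a : bnet_val a \in bounded_nets).
  have : bigO (fun e => `|a e * x e|%:E) b.
    have [C [e1 [e10 xC]]] := x0 b; exists (M * C), (Num.min e0 e1).
    split=> [|e]; first by rewrite lt_min e00.
    rewrite lt_min => /andP[/aM ? /xC]; rewrite !lee_fin => ?.
    by rewrite normrM -mulrA ler_pM.
  move=> /bigOD /(_ (y0 b)); apply: bigO_le => e.
  by rewrite -EFinD lee_fin ler_normD.
Qed.

HB.instance Definition _ :=
  isIdealr.Build bnet negligible_bnets negligible_bnets_ideal.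

Definition Rtilde_c := {ideal_quot negligible_bnets}.
HB.instance Definition _ := GRing.ComNzRing.on Rtilde_c.
HB.instance Definition _ := Quotient.on Rtilde_c.

Lemma bounded_cst (r : R) : cst r \in bounded_nets.
Proof. by apply/asboolP; exists `|r|, 1; split. Qed.

Definition Rtilde_cst (r : R) : Rtilde_c := \pi_Rtilde_c (Bnet (bounded_cst r)).

End GeneralizedReals.

Section ColombeauAlgebra.
Variables (R : realType) (d : nat).
Local Notation epsI := (epsI R).
Local Notation V := 'cV[R]_d.
Local Notation C := (Rcomplex R).

Definition partial (i : 'I_d) (f : V -> C) : V -> C :=
  fun x => 'D_(delta_mx i 0) f x.

Fixpoint Cn (n : nat) (f : V -> C) : Prop :=
  if n is m.+1 then
    (forall x, differentiable f x) /\ forall i, Cn m (partial i f)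
  else continuous f.

Definition smooth (f : V -> C) : Prop := forall n, Cn n f.

(* [a] is a multi-index; factors are applied with the first coordinate
   outermost. *)
Definition mpartial (a : 'I_d -> nat) (f : V -> C) : V -> C :=
  foldr (fun i => iter (a i) (partial i)) f (enum 'I_d).

Definition net := epsI -> V -> C.
HB.instance Definition _ := GRing.Zmodule.on net.

Definition sup_mpartial (u : net) (K : set V) (a : 'I_d -> nat) :
    epsI -> \bar R :=
  fun e => ereal_sup [set `|mpartial a (u e) x|%:E | x in K].

Definition moderate (u : net) : Prop :=
  (forall e, smooth (u e)) /\
  forall (K : set V) (a : 'I_d -> nat), compact K ->
    exists b : R, bigO (sup_mpartial u K a) b.

Definition negligible (u : net) : Prop :=
  (forall e, smooth (u e)) /\
  forall (K : set V) (a : 'I_d -> nat) (b : R), compact K ->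
    bigO (sup_mpartial u K a) b.

Lemma smooth_diff f x : smooth f -> differentiable f x.
Proof. by move=> /(_ 1%N)[]. Qed.

Lemma smooth_partial i f : smooth f -> smooth (partial i f).
Proof. by move=> sf n; have [_ +] := sf n.+1; exact. Qed.

Lemma partialB i f g : smooth f -> smooth g ->
  partial i (f - g) = partial i f - partial i g.
Proof.
move=> sf sg; apply/funext => x; rewrite /partial.
by apply: deriveB; apply: diff_derivable; apply: smooth_diff.
Qed.

Lemma partial0 i : partial i 0 = 0.
Proof. by apply/funext => x; rewrite /partial (derive_cst (0 : C)). Qed.

Lemma CnB n f g : smooth f -> smooth g -> Cn n (f - g).
Proof.
elim: n f g => [|n IHn] f g sf sg /=.
  by move=> x; apply: continuousB; [exact: (sf 0%N)|exact: (sg 0%N)].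
split=> [x|i]; first by apply: differentiableB; exact: smooth_diff.
by rewrite partialB//; apply: IHn; exact: smooth_partial.
Qed.

Lemma Cn0 n : Cn n 0.
Proof.
elim: n => [|n IHn] /=; first by move=> x; exact: cst_continuous.
by split=> [x|i]; [exact: (differentiable_cst (0 : C))|rewrite partial0].
Qed.

Lemma iter_partialB i n f g : smooth f -> smooth g ->
  [/\ smooth (iter n (partial i) f), smooth (iter n (partial i) g) &
   iter n (partial i) (f - g) = iter n (partial i) f - iter n (partial i) g].
Proof.
move=> sf sg; elim: n => //= n [sfn sgn ->].
by rewrite partialB//; split=> //; exact: smooth_partial.
Qed.

Lemma mpartialB a f g : smooth f -> smooth g ->
  mpartial a (f - g) = mpartial a f - mpartial a g.
Proof.
move=> sf sg; rewrite /mpartial.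
suff H : forall s : seq 'I_d, [/\
  smooth (foldr (fun i => iter (a i) (partial i)) f s),
  smooth (foldr (fun i => iter (a i) (partial i)) g s) &
  foldr (fun i => iter (a i) (partial i)) (f - g) s =
  foldr (fun i => iter (a i) (partial i)) f s -
  foldr (fun i => iter (a i) (partial i)) g s].
  by have [] := H (enum 'I_d).
elim=> //= i s [sfs sgs ->]; have [] := iter_partialB i (a i) sfs sgs.
by split.
Qed.

Lemma mpartial0 a : mpartial a 0 = 0.
Proof.
rewrite /mpartial; elim: (enum _) => //= i s ->.
by elim: (a i) => //= n ->; exact: partial0.
Qed.

Lemma sup_mpartialB (u v : net) K a :
  (forall e, smooth (u e)) -> (forall e, smooth (v e)) -> forall e,
  K !=set0 ->
  (sup_mpartial (u - v)%R K a e <= sup_mpartial u K a e + sup_mpartial v K a e)%E.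
Proof.
move=> su sv e [x0 Kx0]; apply: ge_ereal_sup => _ [x Kx <-].
have -> : (u - v) e = u e - v e by [].
rewrite mpartialB//=.
have leu : (`|mpartial a (u e) x|%:E <= sup_mpartial u K a e)%E.
  by apply: ereal_sup_ubound; exists x.
have lev : (`|mpartial a (v e) x|%:E <= sup_mpartial v K a e)%E.
  by apply: ereal_sup_ubound; exists x.
apply: le_trans (leeD leu lev); rewrite -EFinD lee_fin.
exact: ler_normB.
Qed.

Lemma bigO_sup_mpartialB (u v : net) K a b :
  (forall e, smooth (u e)) -> (forall e, smooth (v e)) ->
  bigO (sup_mpartial u K a) b -> bigO (sup_mpartial v K a) b ->
  bigO (sup_mpartial (u - v) K a) b.
Proof.
move=> su sv ub vb; have [->|/set0P K0] := eqVneq K set0.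
  by apply: bigO0 => e; rewrite /sup_mpartial image_set0 ereal_sup0.
apply: bigO_le (bigOD ub vb) => e; exact: sup_mpartialB.
Qed.

Lemma bigO_sup_mpartial0 K a b : bigO (sup_mpartial 0 K a) b.
Proof.
apply: bigO0 => e; apply: ge_ereal_sup => _ [x Kx <-].
by rewrite mpartial0 normr0.
Qed.

Definition moderate_nets : {pred net} := fun u => `[< moderate u >].

Lemma moderate_nets_zmod_closed : zmod_closed moderate_nets.
Proof.
split=> [|u v /asboolP[su mu] /asboolP[sv mv]]; apply/asboolP; split.
- by move=> e n; exact: Cn0.
- by move=> K a _; exists 0; exact: bigO_sup_mpartial0.
- by move=> e n; exact: CnB.
- move=> K a cK; have [b ub] := mu K a cK; have [c vc] := mv K a cK.
  exists (Num.min b c); apply: bigO_sup_mpartialB => //.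
    by apply: bigO_weak ub; rewrite ge_min lexx.
  by apply: bigO_weak vc; rewrite ge_min lexx orbT.
Qed.

HB.instance Definition _ :=
  GRing.isZmodClosed.Build net moderate_nets moderate_nets_zmod_closed.

Record EM := ModerateNet { EM_val :> net ; _ : EM_val \in moderate_nets }.
HB.instance Definition _ := [isSub for EM_val].
HB.instance Definition _ := [Choice of EM by <:].
HB.instance Definition _ := [SubChoice_isSubZmodule of EM by <:].

Definition negligible_nets : {pred EM} := fun u => `[< negligible u >].

Lemma negligible_nets_zmod_closed : zmod_closed negligible_nets.
Proof.
split=> [|u v /asboolP[su nu] /asboolP[sv nv]]; apply/asboolP; split.
- by move=> e n; exact: Cn0.
- by move=> K a b _; exact: bigO_sup_mpartial0.
- by move=> e n; exact: CnB.
- by move=> K a b cK; apply: bigO_sup_mpartialB; auto.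
Qed.

HB.instance Definition _ :=
  GRing.isZmodClosed.Build EM negligible_nets negligible_nets_zmod_closed.

(* Only the additive structure of the algebra is needed: the classes modulo the
   ideal and their equality are those of the quotient group. *)
Definition colombeau := {ideal_quot negligible_nets}.
HB.instance Definition _ := GRing.Zmodule.on colombeau.
HB.instance Definition _ := Quotient.on colombeau.

(* The class of a net. The value on nets that are not moderate is irrelevant:
   below, it is applied to nets [f_eps \o A_eps] with [f_eps] moderate and
   [A_eps] bounded, which are moderate. *)
Definition net_class (u : net) : colombeau := \pi_colombeau (insubd (0 : EM) u).

(* The class of the result does not depend on the representatives, so it is
   harmless to use the ones chosen by [repr]. *)
Definition comp_mx (f : colombeau) (A : 'M[Rtilde_c R]_d) : colombeau :=
  net_class (fun (e : epsI) (x : V) =>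
    EM_val (repr f) e ((\matrix_(i, j) bnet_val (repr (A i j)) e) *m x)).

End ColombeauAlgebra.

Section IndefiniteOrthogonalGroup.
Variables (S : comNzRingType) (d p : nat).

Definition Bmx : 'M[S]_d := diag_mx (\row_(i < d) if (i < p)%N then 1 else -1).

(* [O(p, d - p, S)]; its elements are invertible since [Bmx] is. *)
Definition Opq : set 'M[S]_d := [set A | A^T *m Bmx *m A = Bmx].

End IndefiniteOrthogonalGroup.
Arguments Opq S d p : clear implicits.

(* Main.v *)
From HB Require Import structures.
From mathcomp Require Import all_boot all_order all_algebra.
From mathcomp Require Import all_classical all_reals all_analysis.
From mathcomp Require Import complex ring lra.
Require Import Defs.

Set Implicit Arguments.
Unset Strict Implicit.
Unset Printing Implicit Defensive.

Import Order.TTheory GRing.Theory Num.Theory.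
Import numFieldNormedType.Exports.

Local Open Scope classical_set_scope.
Local Open Scope ring_scope.
Local Open Scope quotient_scope.

(** Real matrices of [O(p, q)] are generalized ones, through constant nets
    ([Opq_cst]), so only one implication has content: invariance under each
    fixed real matrix must give invariance under a net of matrices [A_e] that
    varies with [e]. For this, the estimates expressing the invariance of [f]
    have to be uniform in the matrix.

    The uniformity comes from the Baire category theorem. Fix a compact set, a
    derivative and an exponent. By hypothesis each real matrix [A] of the group
    satisfies the corresponding estimate of [f_e o A - f_e], with a constant and
    a range of [e] depending on [A]. The matrices for which the constant [k] is
    good for all [e < 1/(k+1)] form a closed set ([invariance_level]), and these
    countably many sets cover the group, which is itself closed in the space of
    matrices: one of them has an interior point relative to the group
    ([local_uniformity]). Translations of the group move
    this point to any other ([translated_uniformity]), and the compactness of the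
    bounded parts of the group gives one estimate on each of them
    ([compact_uniformity]).

    It remains to reach the matrices that are involved. A generalized matrix in
    [O(p, q)] has a representative that preserves the form up to a negligible
    error only. A quantitative Gram-Schmidt process ([near_congruence]) corrects
    it, for small [e], into a net of elements of the real group that represents
    the same matrix ([exact_representative]), to which the uniform estimate
    applies. Changing the representative of the matrix changes the composition by
    a negligible net ([pullback_close]), and composing with a bounded net of
    matrices preserves moderateness ([moderate_pullback]).

    The last two facts rest on the chain rule. It yields partial derivatives in
    every order, whereas the seminorms that define moderate and negligible nets
    use a fixed order; the symmetry of second derivatives ([partialC]) bridges
    the gap. *)

(** * Complex-valued functions along a line *)

Lemma Rcomplex_normRe (R : realType) (z : Rcomplex R) : `|complex.Re z| <= `|z|.
Proof.
case: z => a b; rewrite [leRHS]/Num.norm/= -sqrtr_sqr.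
by rewrite ler_sqrt ?lerDl ?addr_ge0 ?sqr_ge0.
Qed.

Lemma Rcomplex_normIm (R : realType) (z : Rcomplex R) : `|complex.Im z| <= `|z|.
Proof.
case: z => a b; rewrite [leRHS]/Num.norm/= -sqrtr_sqr.
by rewrite ler_sqrt ?lerDr ?addr_ge0 ?sqr_ge0.
Qed.

Lemma Rcomplex_norm_le (R : realType) (z : Rcomplex R) :
  `|z| <= `|complex.Re z| + `|complex.Im z|.
Proof.
case: z => a b; rewrite [leLHS]/Num.norm/=.
rewrite -(ler_pXn2r (n := 2)) ?nnegrE ?sqrtr_ge0 ?addr_ge0//.
rewrite sqr_sqrtr ?addr_ge0 ?sqr_ge0// sqrrD !real_normK ?num_real//.
by rewrite lerD2r lerDl mulrn_wge0// mulr_ge0.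
Qed.

Section Line.
Variables (R : realType) (d : nat).
Local Notation V := 'cV[R]_d.
Local Notation C := (Rcomplex R).

Lemma norm_le_continuous (L : {linear C -> R}) :
  (forall z, `|L z| <= `|z|) -> continuous L.
Proof.
move=> Ll z; apply/(@cvgrPdist_lt _ _ _ (nbhs z) (nbhs_filter z)) => e e0.
apply/nbhs_ballP; exists e => //= y.
by rewrite -ball_normE /= -linearB; apply: le_lt_trans.
Qed.

Lemma is_derive_line (L : {linear C -> R}) (f : V -> C) (x v : V) (t : R) :
  (forall z, `|L z| <= `|z|) -> differentiable f (x + t *: v) ->
  is_derive t 1 (fun s => L (f (x + s *: v))) (L ('D_v f (x + t *: v))).
Proof.
move=> Ll /(@diff_derivable _ _ _ _ _ v) df.
have H : h^-1 *: (L (f (x + (h *: 1 + t) *: v)) - L (f (x + t *: v)))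
    @[h --> 0^'] --> L ('D_v f (x + t *: v)).
  have := cvg_comp _ _ df (@norm_le_continuous L Ll _).
  apply: cvg_trans; apply: near_eq_cvg; apply: nearW => h /=.
  rewrite linearZ/= linearB/=; congr (_ *: (L (f _) - _)).
  by rewrite scalerDl addrCA -[h *: 1]/(h * 1) mulr1.
apply: DeriveDef; first exact: cvgP H.
by apply: cvg_lim H => //; exact: norm_hausdorff.
Qed.

(** The mean value theorem needs a real-valued function: a complex function is
    studied through a real functional [L] with [`|L z| <= `|z|], which will be
    the real or the imaginary part. *)
Lemma line_MVT (L : {linear C -> R}) (f : V -> C) (x v : V) (a : R) :
  (forall z, `|L z| <= `|z|) -> (forall y, differentiable f y) -> 0 < a ->
  exists2 t, 0 < t < a &
    L (f (x + a *: v)) - L (f x) = a * L ('D_v f (x + t *: v)).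
Proof.
move=> Ll df a0.
have D t := is_derive_line (v := v) Ll (df (x + t *: v)).
have [|t] := MVT a0 (fun t _ => D t).
  by apply: derivable_within_continuous => t _; have [] := D t.
rewrite in_itv/= => ta; rewrite scale0r addr0 subr0 mulrC => E.
by exists t.
Qed.

End Line.

(** * Symmetry of second partial derivatives *)
Section Schwarz.
Variables (R : realType) (d : nat).
Local Notation V := 'cV[R]_d.
Local Notation C := (Rcomplex R).

Lemma differentiable_shift (f : V -> C) (a x : V) :
  differentiable f (x + a) -> differentiable (fun y => f (y + a)) x.
Proof.
move=> df; apply: (@differentiable_comp _ _ _ _ (fun y => y + a) f) => //.
Qed.

Lemma derive_shiftr (f : V -> C) (a x v : V) :
  'D_v (fun y => f (y + a)) x = 'D_v f (x + a).
Proof. by rewrite /derive; under eq_fun do rewrite /= -addrA. Qed.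

(** Two applications of the mean value theorem: first in the direction [v], to
    the difference of [f] along [h *: w], then in the direction [w]. Up to the
    exchange of its two middle terms, the left-hand side is symmetric in [v]
    and [w], which is where the symmetry of second derivatives comes from. *)
Lemma second_difference (L : {linear C -> R}) (f : V -> C) (x v w : V) (h : R) :
  (forall z, `|L z| <= `|z|) -> (forall y, differentiable f y) ->
  (forall y, differentiable ('D_v f) y) -> 0 < h ->
  exists s t, [/\ 0 < s < h, 0 < t < h &
    L (f (x + h *: v + h *: w) - f (x + h *: v) - f (x + h *: w) + f x) =
    h * (h * L ('D_w ('D_v f) (x + s *: v + t *: w)))].
Proof.
move=> Ll df dvf h0.
pose g y := f (y + h *: w) - f y.
have dg y : differentiable g y.
  by apply: differentiableB => //; exact: differentiable_shift.
have [s sh E] := line_MVT x v Ll dg h0.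
have [t th F] := line_MVT (x + s *: v) w Ll dvf h0.
exists s, t; split => //; rewrite -F -linearB -[X in L X = _]/(_ + _).
transitivity (L (g (x + h *: v)) - L (g x)).
  by rewrite -linearB /g; congr (L _); rewrite opprB addrA addrAC.
rewrite E; congr (_ * L _); rewrite deriveB; last 2 first.
- exact/diff_derivable/differentiable_shift.
- exact/diff_derivable.
by rewrite derive_shiftr.
Qed.

Lemma no_midpoint (a b c c' : R) : c = c' ->
  `|a - c| < `|a - b| / 2 -> `|b - c'| < `|a - b| / 2 -> False.
Proof.
move=> <-; rewrite [`|b - c|]distrC => A B; have := ltrD A B.
rewrite -splitr ltNge => /negP; apply.
by apply: le_trans (ler_normD _ _); rewrite addrA subrK.
Qed.

(** If the two mixed derivatives differed at [x], then by continuity they would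
    still be separated on a ball around [x]; but for a small increment [h] both
    equal [h ^- 2] times the same second difference, at two points of that
    ball. *)
Lemma linear_Schwarz (L : {linear C -> R}) (f : V -> C) (x v w : V) :
  (forall z, `|L z| <= `|z|) -> (forall y, differentiable f y) ->
  (forall y, differentiable ('D_v f) y) ->
  (forall y, differentiable ('D_w f) y) ->
  {for x, continuous ('D_w ('D_v f))} -> {for x, continuous ('D_v ('D_w f))} ->
  L ('D_w ('D_v f) x) = L ('D_v ('D_w f) x).
Proof.
move=> Ll df dv dw cwv cvw.
have lc := norm_le_continuous Ll.
apply/eqP; rewrite -subr_eq0; apply/negPn/negP => n0.
set e := `|L ('D_w ('D_v f) x) - L ('D_v ('D_w f) x)|.
have e0 : 0 < e / 2 by rewrite divr_gt0// normr_gt0.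
have near_x (g : V -> C) : {for x, continuous g} ->
    exists2 r, 0 < r & forall u, `|u| < r -> `|L (g x) - L (g (x + u))| < e / 2.
  move=> cg; have : (fun y => L (g y)) y @[y --> x] --> L (g x).
    by apply: (cvg_comp _ _ cg); exact: lc.
  move=> /(@cvgrPdist_lt _ _ _ _ (nbhs_filter x)) /(_ _ e0) /nbhs_ballP[r r0 H].
  by exists r => // u ur; apply: H; rewrite -ball_normE /= opprD addNKr normrN.
have [r r0 Hr] := near_x _ cwv; have [r' r'0 Hr'] := near_x _ cvw.
pose m := Num.min r r'; pose h := m / 2 / (1 + `|v| + `|w|).
(* [h] is such that every [s *: v + t *: w] with [0 < s, t < h] has norm < [m]. *)
have m0 : 0 < m by rewrite lt_min r0.
have k0 : 0 < 1 + `|v| + `|w| by rewrite -addrA ltr_pwDl// addr_ge0.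
have h0 : 0 < h by rewrite !divr_gt0.
have small s t : 0 < s < h -> 0 < t < h -> `|s *: v + t *: w| < m.
  move=> /andP[s0 sh] /andP[t0 th].
  apply: le_lt_trans (ler_normD _ _) _; rewrite !normrZ (gtr0_norm s0) (gtr0_norm t0).
  apply: (@le_lt_trans _ _ (h * (1 + `|v| + `|w|))).
    rewrite -addrA mulrDr mulr1 mulrDr ler_wpDl ?(ltW h0)//.
    by rewrite lerD// ler_wpM2r// ltW.
  by rewrite divfK ?gt_eqF// ltr_pdivrMr// ltr_pMr// ltr1n.
have [s [t [sh th E]]] := second_difference x w Ll df dv h0.
have [t' [s' [th' sh' E']]] := second_difference x v Ll df dw h0.
have EE : L ('D_w ('D_v f) (x + (s *: v + t *: w))) =
    L ('D_v ('D_w f) (x + (t' *: w + s' *: v))).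
  apply: (mulfI (lt0r_neq0 h0)); apply: (mulfI (lt0r_neq0 h0)).
  rewrite !addrA -[LHS]E -[RHS]E'; congr (L _).
  by rewrite [x + h *: w + h *: v]addrAC [f _ - f (x + h *: w) - _]addrAC.
have um : `|s *: v + t *: w| < r.
  by apply: (lt_le_trans (small _ _ sh th)); rewrite ge_min lexx.
have um' : `|t' *: w + s' *: v| < r'.
  rewrite [t' *: w + s' *: v]addrC.
  by apply: (lt_le_trans (small _ _ sh' th')); rewrite ge_min lexx orbT.
exact: (no_midpoint EE (Hr _ um) (Hr' _ um')).
Qed.

Lemma partialC (f : V -> C) i j : smooth f ->
  partial i (partial j f) = partial j (partial i f).
Proof.
move=> sf; apply/funext => x.
have df k y : differentiable (partial k f) y by exact/smooth_diff/smooth_partial.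
have cf k l : continuous (partial k (partial l f)).
  exact: (smooth_partial k (smooth_partial l sf) 0%N).
have S (L : {linear C -> R}) : (forall z, `|L z| <= `|z|) ->
    L (partial i (partial j f) x) = L (partial j (partial i f) x).
  move=> Ll; apply: linear_Schwarz Ll _ _ _ (cf _ _ _) (cf _ _ _).
  - by move=> y; exact: smooth_diff.
  - exact: df.
  - exact: df.
have := S (@complex.Re R : {linear C -> R}) (@Rcomplex_normRe R).
have := S (@complex.Im R : {linear C -> R}) (@Rcomplex_normIm R).
by case: (partial i _ _) => a b; case: (partial j _ _) => a' b' /= -> ->.
Qed.

End Schwarz.

(** * Iterated partial derivatives *)
Section IteratedPartials.
Variables (R : realType) (d : nat).
Local Notation V := 'cV[R]_d.
Local Notation C := (Rcomplex R).
Implicit Types (f g : V -> C) (s : seq 'I_d).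

(** Partial derivatives are indexed by lists of coordinates rather than by
    multi-indices: the chain rule produces them in arbitrary order, and lists
    allow an induction on the number of derivatives. *)
Definition partials s f : V -> C := foldr (@partial R d) f s.

Lemma smooth_partials s f : smooth f -> smooth (partials s f).
Proof. by move=> sf; elim: s => //= i s; exact: smooth_partial. Qed.

Lemma partials_cat s t f : partials (s ++ t) f = partials s (partials t f).
Proof. by rewrite /partials foldr_cat. Qed.

Lemma partials_rcons s i f : partials (rcons s i) f = partials s (partial i f).
Proof. by rewrite -cats1 partials_cat. Qed.

Lemma partialsC s t f : smooth f ->
  partials s (partials t f) = partials t (partials s f).
Proof.
move=> sf; elim: s => //= i s ->.
elim: t => //= j t <-; rewrite partialC//.
by do 2!apply: smooth_partials.
Qed.

Lemma perm_partials s t f : smooth f -> perm_eq s t -> partials s f = partials t f.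
Proof.
move=> sf st.
apply: (catCA_perm_ind (P := fun t => partials s f = partials t f) _ st) => //.
move=> s1 s2 s3 ->; rewrite !partials_cat partialsC//.
exact: smooth_partials.
Qed.

Lemma mpartialE (a : 'I_d -> nat) f :
  mpartial a f = partials (flatten [seq nseq (a i) i | i <- enum 'I_d]) f.
Proof.
rewrite /mpartial; elim: (enum _) => //= i s ->.
by rewrite partials_cat; elim: (a i) => //= n ->.
Qed.

(** By the symmetry of second derivatives the order of differentiation can be
    normalized, so that the multi-indices control all lists. *)
Lemma partials_mpartial s f : smooth f ->
  partials s f = mpartial (fun i => count_mem i s) f.
Proof.
move=> sf; rewrite mpartialE; apply: perm_partials => //.
rewrite /perm_eq; apply/allP => i _ /=.
rewrite count_flatten -map_comp sumnE big_map big_enum/= (bigD1 i)//=.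
rewrite count_nseq/= eqxx mul1n.
rewrite big1 ?addn0// => j ji; rewrite count_nseq/=.
by rewrite (negbTE ji).
Qed.

Lemma CnZ n (k : R) f : Cn n f -> Cn n (k *: f).
Proof.
elim: n f => [|n IHn] f /=.
  by move=> cf x; apply: (cvgZl_tmp (FF := nbhs_filter x)); exact: cf.
move=> [df cf]; split=> [x|i]; first exact: differentiableZ.
suff -> : partial i (k *: f) = k *: partial i f by exact: IHn.
by apply/funext => x; rewrite /partial deriveZ//; exact: diff_derivable.
Qed.

Lemma CnD n f g : Cn n f -> Cn n g -> Cn n (f + g).
Proof.
elim: n f g => [|n IHn] f g /=.
  by move=> cf cg x; apply: continuousD; [exact: cf|exact: cg].
move=> [df cf] [dg cg]; split=> [x|i]; first exact: differentiableD.
suff -> : partial i (f + g) = partial i f + partial i g by exact: IHn.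
by apply/funext => x; rewrite /partial deriveD//; exact: diff_derivable.
Qed.

Lemma smoothZ (k : R) f : smooth f -> smooth (k *: f).
Proof. by move=> sf n; exact: CnZ. Qed.

Lemma smoothD f g : smooth f -> smooth g -> smooth (f + g).
Proof. by move=> sf sg n; exact: CnD. Qed.

Lemma smoothB f g : smooth f -> smooth g -> smooth (f - g).
Proof. by move=> sf sg n; exact: CnB. Qed.

Lemma smooth0 : smooth (0 : V -> C).
Proof. by move=> n; exact: Cn0. Qed.

Lemma partialZ i (k : R) f : smooth f -> partial i (k *: f) = k *: partial i f.
Proof.
move=> sf; apply/funext => x; rewrite /partial deriveZ//.
exact/diff_derivable/smooth_diff.
Qed.

Lemma partialsB s f g : smooth f -> smooth g ->
  partials s (f - g) = partials s f - partials s g.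
Proof.
move=> sf sg; elim: s => //= i s ->; rewrite partialB//; exact: smooth_partials.
Qed.

Lemma partialsZ s (k : R) f : smooth f -> partials s (k *: f) = k *: partials s f.
Proof.
move=> sf; elim: s => //= i s ->; rewrite partialZ//; exact: smooth_partials.
Qed.

Lemma partials0 s : partials s (0 : V -> C) = 0.
Proof. by elim: s => //= i s ->; exact: partial0. Qed.

Lemma partialsD s f g : smooth f -> smooth g ->
  partials s (f + g) = partials s f + partials s g.
Proof.
move=> sf sg; have -> : f + g = f - (0 - g) by rewrite sub0r opprK.
have s0 := smooth0; rewrite !partialsB//; last exact: smoothB.
by rewrite partials0 sub0r opprK.
Qed.

Lemma smooth_sum (I : Type) (r : seq I) (F : I -> V -> C) :
  (forall i, smooth (F i)) -> smooth (\sum_(i <- r) F i).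
Proof.
by move=> sF; elim/big_ind: _ => // [|*]; [exact: smooth0|exact: smoothD].
Qed.

Lemma partials_sum (I : Type) (r : seq I) (F : I -> V -> C) s :
  (forall i, smooth (F i)) ->
  partials s (\sum_(i <- r) F i) = \sum_(i <- r) partials s (F i).
Proof.
move=> sF; elim: r => [|i r IHr]; first by rewrite !big_nil partials0.
by rewrite !big_cons partialsD ?IHr//; exact: smooth_sum.
Qed.

End IteratedPartials.

(** * Norm and convergence of matrices *)
Section MatrixNorm.
Variable R : realType.

Lemma mx_norm_leP m n (M : 'M[R]_(m, n)) c : 0 <= c ->
  reflect (forall i j, `|M i j| <= c) (`|M| <= c).
Proof.
move=> c0; rewrite [leLHS]/Num.norm/= mx_normrE.
apply: (iffP idP) => [/bigmax_leP[_ H] i j|H]; first exact: (H (i, j)).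
by apply/bigmax_leP; split=> // -[i j] _; exact: H.
Qed.

Lemma mx_norm_coord m n (M : 'M[R]_(m, n)) i j : `|M i j| <= `|M|.
Proof. by move: i j; apply/mx_norm_leP. Qed.

Lemma mulmx_norm m n p (A : 'M[R]_(m, n)) (B : 'M[R]_(n, p)) :
  `|A *m B| <= n%:R * `|A| * `|B|.
Proof.
apply/mx_norm_leP => [|i j]; first by rewrite !mulr_ge0.
rewrite mxE; apply: le_trans (ler_norm_sum _ _ _) _.
rewrite -mulrA -[n in n%:R]card_ord -sum1_card natr_sum mulr_suml.
apply: ler_sum => k _; rewrite mul1r normrM.
by apply: ler_pM => //; exact: mx_norm_coord.
Qed.

(** Entrywise convergence suffices: a neighborhood of a matrix is given by
    finitely many neighborhoods of its entries. *)
Lemma cvg_mx (T : Type) (F : set_system T) (FF : Filter F) m n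
    (f : T -> 'M[R]_(m, n)) (M : 'M[R]_(m, n)) :
  (forall i j, f t i j @[t --> F] --> M i j) -> f @ F --> M.
Proof.
move=> fM P [Q MQ QP]; rewrite /nbhs/=.
have : \forall t \near F, forall i j, Q i j (f t i j).
  apply: filter_forall => i; apply: filter_forall => j; exact: fM.
by apply: filterS => t Qt; apply: QP.
Qed.

Lemma cvg_mulmx (T : Type) (F : set_system T) (FF : Filter F) m n p
    (f : T -> 'M[R]_(m, n)) (g : T -> 'M[R]_(n, p))
    (A : 'M[R]_(m, n)) (B : 'M[R]_(n, p)) :
  f @ F --> A -> g @ F --> B -> f t *m g t @[t --> F] --> A *m B.
Proof.
move=> fA gB; apply: cvg_mx => i j.
under eq_cvg do rewrite mxE; rewrite mxE.
apply: (cvg_big (op := +%R)) => [|k _].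
  exact: add_continuous.
apply: cvgM.
  exact: (cvg_comp _ _ fA (@coord_continuous R m n i k A)).
exact: (cvg_comp _ _ gB (@coord_continuous R n p k j B)).
Qed.

Lemma continuous_mulmx m n p (A : 'M[R]_(m, n)) :
  continuous (mulmx A : 'M[R]_(n, p) -> 'M[R]_(m, p)).
Proof.
move=> B; apply: (@cvg_mulmx _ _ (nbhs_filter B) _ _ _ (cst A) id) => //.
exact: (@cvg_cst _ A _ (nbhs B) (nbhs_filter B)).
Qed.

End MatrixNorm.

(** * Composition with a linear map *)
Section Pullback.
Variables (R : realType) (d : nat).
Local Notation V := 'cV[R]_d.
Local Notation C := (Rcomplex R).
Implicit Types (A B : 'M[R]_d) (f g : V -> C) (s : seq 'I_d).

Definition pullback A g : V -> C := fun x => g (A *m x).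

Lemma pullbackB A f g : pullback A (f - g) = pullback A f - pullback A g.
Proof. by []. Qed.

Lemma pullbackM A B g : pullback (A *m B) g = pullback B (pullback A g).
Proof. by apply/funext => x; rewrite /pullback mulmxA. Qed.

Lemma differentiable_pullback A g x :
  differentiable g (A *m x) -> differentiable (pullback A g) x.
Proof.
move=> dg; apply: (@differentiable_comp _ _ _ _ (mulmx A) g) => //.
apply: (@linear_differentiable _ _ _ (mulmx A : {linear V -> V})).
exact: continuous_mulmx.
Qed.

Lemma derive_pullback A g x v :
  'D_v (pullback A g) x = 'D_(A *m v) g (A *m x).
Proof.
rewrite /derive /pullback.
by under eq_fun do rewrite /= mulmxDr -scalemxAr.
Qed.

Lemma derive_coord g (w y : V) : differentiable g y ->
  'D_w g y = \sum_j w j 0 *: partial j g y.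
Proof.
move=> dg; rewrite deriveE// {1}[w]matrix_sum_delta linear_sum.
apply: eq_bigr => j _; rewrite big_ord1 linearZ/=.
by rewrite /partial deriveE.
Qed.

Lemma partial_pullback A g i : (forall y, differentiable g y) ->
  partial i (pullback A g) = \sum_j A j i *: pullback A (partial j g).
Proof.
move=> dg; apply/funext => x; rewrite fct_sumE /partial derive_pullback derive_coord//.
by apply: eq_bigr => j _; rewrite -colE mxE.
Qed.

Lemma smooth_pullback A g : smooth g -> smooth (pullback A g).
Proof.
move=> sg n; elim: n g sg => [|n IHn] g sg /=.
  move=> x; apply: (cvg_comp _ _ (@continuous_mulmx _ _ _ _ A x)).
  exact: (sg 0%N).
split=> [x|i]; first exact/differentiable_pullback/smooth_diff.
rewrite partial_pullback; last by move=> y; exact: smooth_diff.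
elim/big_ind: _ => [||j _]; [exact: Cn0|by move=> *; exact: CnD|].
exact/CnZ/IHn/smooth_partial.
Qed.

(** The chain rule, applied to the innermost derivative. It expresses the
    derivatives of [pullback A g] of order [n + 1] by the derivatives of order
    [n] of the functions [pullback A (partial j g)]; the estimates below are
    therefore proved by induction on the list from the right, for all [g]. *)
Lemma partials_rcons_pullback A g s i : smooth g ->
  partials (rcons s i) (pullback A g) =
  \sum_j A j i *: partials s (pullback A (partial j g)).
Proof.
move=> sg; rewrite partials_rcons partial_pullback; last first.
  by move=> y; exact: smooth_diff.
have sp j : smooth (pullback A (partial j g)).
  exact/smooth_pullback/smooth_partial.
rewrite partials_sum => [|j]; last exact: smoothZ.
by apply: eq_bigr => j _; rewrite partialsZ.
Qed.

Lemma continuous_partials_pullback g s x : smooth g ->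
  continuous (fun A => partials s (pullback A g) x).
Proof.
elim/last_ind: s g => [|s i IHs] g sg A /=.
  have H : B *m x @[B --> A] --> A *m x.
    apply: (@cvg_mulmx _ _ _ (nbhs_filter A) _ _ _ id (cst x)) => //.
    exact: (@cvg_cst _ x _ (nbhs A) (nbhs_filter A)).
  apply: (cvg_comp _ _ H); exact: (sg 0%N).
rewrite /continuous_at.
under eq_cvg do rewrite partials_rcons_pullback// fct_sumE.
rewrite partials_rcons_pullback// fct_sumE.
apply: (cvg_big (op := +%R) _ (nbhs_filter A)) => [|j _].
  exact: add_continuous.
apply: (@cvgZ _ _ _ (nbhs A) (nbhs_filter A)); first exact: coord_continuous.
exact/IHs/smooth_partial.
Qed.

(** The factor 2 comes from treating real and imaginary parts separately. *)
Lemma mean_value_bound g x y N : (forall z, differentiable g z) ->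
  (forall j t, 0 < t < 1 -> `|partial j g (x + t *: (y - x))| <= N) ->
  `|g y - g x| <= 2 * (d%:R * `|y - x| * N).
Proof.
move=> dg gN.
have H (L : {linear C -> R}) : (forall z, `|L z| <= `|z|) ->
    `|L (g y - g x)| <= d%:R * `|y - x| * N.
  move=> Ll; have [t t01] := line_MVT x (y - x) Ll dg ltr01.
  rewrite scale1r [x + _]addrC subrK mul1r -linearB => ->.
  apply: le_trans (Ll _) _; rewrite derive_coord//.
  apply: le_trans (ler_norm_sum _ _ _) _.
  rewrite -mulrA -[d in d%:R]card_ord -sum1_card natr_sum mulr_suml.
  apply: ler_sum => k _; rewrite mul1r normrZ.
  by apply: ler_pM => //; [exact: mx_norm_coord|exact: gN].
rewrite mulr_natl mulr2n; apply: le_trans (Rcomplex_norm_le _) _.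
apply: lerD.
  exact: (H (@complex.Re R : {linear C -> R}) (@Rcomplex_normRe R)).
exact: (H (@complex.Im R : {linear C -> R}) (@Rcomplex_normIm R)).
Qed.

End Pullback.

(** * Uniform O-estimates *)
Section UniformO.
Variable R : realType.
Local Notation epsI := (epsI R).

(** [F e t = O(e ^ b)], uniformly in the parameters [t] allowed at [e]. The
    parameter may be a point of a compact set, or a pair of a matrix and a
    point. *)
Definition uniformO (T : Type) (Q : epsI -> set T) (F : epsI -> T -> R) (b : R) :=
  exists C e0 : R, 0 < e0 /\
    forall e t, val e < e0 -> Q e t -> F e t <= C * val e `^ b.

Section Rules.
Variables (T : Type) (Q : epsI -> set T).
Implicit Types (F G : epsI -> T -> R) (b c : R).

Lemma uniformO_le F G b : (forall e t, Q e t -> F e t <= G e t) ->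
  uniformO Q G b -> uniformO Q F b.
Proof.
move=> FG [C [e0 [e00 H]]]; exists C, e0; split=> // e t ee0 Qt.
exact: le_trans (FG _ _ Qt) (H _ _ ee0 Qt).
Qed.

Lemma uniformO_weak F b c : c <= b -> uniformO Q F b -> uniformO Q F c.
Proof.
move=> cb [C [e0 [e00 H]]]; exists `|C|, e0; split=> // e t ee0 Qt.
apply: le_trans (H _ _ ee0 Qt) _.
apply: (le_trans (ler_wpM2r (powR_ge0 _ _) (ler_norm C))).
by rewrite ler_wpM2l//; apply: powR_le01 cb; exact: (svalP e).
Qed.

Lemma uniformO0 b : uniformO Q (fun _ _ => 0) b.
Proof. by exists 0, 1; split=> // e t _ _; rewrite mul0r. Qed.

Lemma uniformOD F G b : uniformO Q F b -> uniformO Q G b ->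
  uniformO Q (fun e t => F e t + G e t) b.
Proof.
move=> [C [e0 [e00 H]]] [D [e1 [e10 K]]]; exists (C + D), (Num.min e0 e1).
split=> [|e t]; first by rewrite lt_min e00.
by rewrite lt_min mulrDl => /andP[/H + /K +] Qt => /(_ _ Qt) ? /(_ _ Qt) ?; exact: lerD.
Qed.

Lemma uniformO_sum (I : Type) (r : seq I) (F : I -> epsI -> T -> R) b :
  (forall i, uniformO Q (F i) b) ->
  uniformO Q (fun e t => \sum_(i <- r) F i e t) b.
Proof.
move=> H; elim: r => [|i r IHr].
  by apply: uniformO_le (uniformO0 b) => e t _; rewrite big_nil.
by apply: uniformO_le (uniformOD (H i) IHr) => e t _; rewrite big_cons.
Qed.

Lemma uniformOM F G b c :
  (forall e t, Q e t -> 0 <= F e t) -> (forall e t, Q e t -> 0 <= G e t) ->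
  uniformO Q F b -> uniformO Q G c ->
  uniformO Q (fun e t => F e t * G e t) (b + c).
Proof.
move=> F0 G0 [C [e0 [e00 H]]] [D [e1 [e10 K]]]; exists (C * D), (Num.min e0 e1).
split=> [|e t]; first by rewrite lt_min e00.
rewrite lt_min => /andP[/H + /K +] Qt => /(_ _ Qt) HF /(_ _ Qt) HG.
have /andP[ep _] := svalP e.
rewrite powRD; last by rewrite (gt_eqF ep) implybT.
by rewrite mulrACA; apply: ler_pM => //; [exact: F0|exact: G0].
Qed.

Lemma uniformOZ F b k : 0 <= k -> uniformO Q F b ->
  uniformO Q (fun e t => k * F e t) b.
Proof.
move=> k0 [C [e0 [e00 H]]]; exists (k * C), e0; split=> // e t ee0 Qt.
by rewrite -mulrA ler_wpM2l//; exact: H.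
Qed.

Lemma uniformO_eventually F b e1 : 0 < e1 ->
  uniformO (fun e t => val e < e1 /\ Q e t) F b -> uniformO Q F b.
Proof.
move=> e10 [C [e0 [e00 H]]]; exists C, (Num.min e0 e1).
split=> [|e t]; first by rewrite lt_min e00.
by rewrite lt_min => /andP[? ?] Qt; apply: H.
Qed.

Lemma uniformO_reindex (U : Type) (P : epsI -> set U) (h : epsI -> U -> T)
    F b :
  (forall e u, P e u -> Q e (h e u)) -> uniformO Q F b ->
  uniformO P (fun e u => F e (h e u)) b.
Proof.
move=> PQ [C [e0 [e00 H]]]; exists C, e0; split=> // e u ee0 /PQ.
exact: H.
Qed.

End Rules.

End UniformO.

(** * Moderateness and negligibility in terms of lists of partials *)
Section Estimates.
Variables (R : realType) (d : nat).
Local Notation epsI := (epsI R).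
Local Notation V := 'cV[R]_d.
Local Notation C := (Rcomplex R).
Implicit Types (u : net R d) (K : set V) (s : seq 'I_d).

Lemma bigO_sup_mpartialP u K a b : bigO (sup_mpartial u K a) b <->
  uniformO (fun _ => K) (fun e x => `|mpartial a (u e) x|) b.
Proof.
split=> -[M [e0 [e00 H]]]; exists M, e0; split=> // e.
  move=> x ee0 Kx; rewrite -lee_fin; apply: le_trans (H _ ee0).
  by apply: ereal_sup_ubound; exists x.
move=> ee0; apply: ge_ereal_sup => _ [x Kx <-]; rewrite lee_fin.
exact: H.
Qed.

Lemma moderateP u : moderate u <-> (forall e, smooth (u e)) /\
  forall K s, compact K ->
    exists b, uniformO (fun _ => K) (fun e x => `|partials s (u e) x|) b.
Proof.
split=> -[su H]; split=> // K s cK.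
  have [b /bigO_sup_mpartialP Hb] := H K (fun i => count_mem i s) cK.
  by exists b; apply: uniformO_le Hb => e x _; rewrite partials_mpartial.
have [b Hb] := H K (flatten [seq nseq (s i) i | i <- enum 'I_d]) cK.
exists b; apply/bigO_sup_mpartialP; apply: uniformO_le Hb => e x _.
by rewrite mpartialE.
Qed.

Lemma negligibleP u : negligible u <-> (forall e, smooth (u e)) /\
  forall K s b, compact K ->
    uniformO (fun _ => K) (fun e x => `|partials s (u e) x|) b.
Proof.
split=> -[su H]; split=> // K s b cK.
  have /bigO_sup_mpartialP := H K (fun i => count_mem i s) b cK.
  by apply: uniformO_le => e x _; rewrite partials_mpartial.
apply/bigO_sup_mpartialP.
apply: uniformO_le (H K (flatten [seq nseq (s i) i | i <- enum 'I_d]) b cK).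
by move=> e x _; rewrite mpartialE.
Qed.

(** There are finitely many lists of a given size, so one exponent serves them
    all. *)
Lemma common_order T (Q : epsI -> set T) (F : seq 'I_d -> epsI -> T -> R) n :
  (forall s, exists b, uniformO Q (F s) b) ->
  exists b, forall s, size s = n -> uniformO Q (F s) b.
Proof.
move=> /choice[b Hb].
exists (\big[Num.min/0]_(s : n.-tuple 'I_d) b s) => s /eqP sn.
apply: uniformO_weak (Hb s); rewrite -[s in b s]/(val (Tuple sn)).
exact: bigmin_le_cond.
Qed.

(** Composition with a bounded family of matrices preserves the order of growth:
    each use of the chain rule costs a factor bounded by [d * c]. *)
Lemma partials_pullback_estimate T (Q : epsI -> set T)
    (A : epsI -> T -> 'M[R]_d) (x : epsI -> T -> V) (g : net R d) K c s b :
  (forall e, smooth (g e)) ->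
  (forall e t, Q e t -> `|A e t| <= c /\ K (A e t *m x e t)) ->
  (forall s', size s' = size s ->
     uniformO (fun _ => K) (fun e y => `|partials s' (g e) y|) b) ->
  uniformO Q (fun e t => `|partials s (pullback (A e t) (g e)) (x e t)|) b.
Proof.
move=> + QA; elim/last_ind: s g => [|s i IHs] g sg Hg.
  apply: (uniformO_reindex (h := fun e t => A e t *m x e t) _ (Hg [::] _)) => //.
  by move=> e t /QA[].
have [[e [t /QA[/(le_trans (normr_ge0 _)) c0 _]]]|noQ] :=
  pselect (exists e t, Q e t); last first.
  exists 0, 1; split=> // e t _ Qt; exfalso; apply: noQ.
  by exists e, t.
have H j : uniformO Q (fun e t => c *
    `|partials s (pullback (A e t) (partial j (g e))) (x e t)|) b.
  apply: uniformOZ => //; apply: (IHs (fun e => partial j (g e))) => [e'|s' ss'].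
    exact: smooth_partial.
  have := Hg (rcons s' j); rewrite !size_rcons ss' => /(_ erefl).
  by apply: uniformO_le => e' y _; rewrite partials_rcons.
apply: uniformO_le (uniformO_sum (index_enum _) H) => {c0 e t} e t Qt.
rewrite partials_rcons_pullback// fct_sumE.
apply: le_trans (ler_norm_sum _ _ _) _; apply: ler_sum => j _.
rewrite normrZ ler_wpM2r//; apply: le_trans (mx_norm_coord _ _ _) _.
by have [] := QA _ _ Qt.
Qed.

(** Heine-Borel for row vectors, transported along [vec_mx]. *)
Lemma compact_mx_ball m n (r : R) : compact [set M : 'M[R]_(m, n) | `|M| <= r].
Proof.
have [r0|r0] := ltP r 0.
  rewrite (_ : mkset _ = set0); first exact: compact0.
  by apply/seteqP; split=> // M /=; rewrite leNgt (lt_le_trans r0).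
have cB : compact [set v : 'rV[R]_(m * n) | `|v| <= r].
  apply: bounded_closed_compact.
    exists r; split=> [|N rN v /= vr]; first exact: num_real.
    exact: le_trans vr (ltW rN).
  apply: (preimage_closed _ (@closed_le _ r)) => v _.
  exact: norm_continuous.
have /(@continuous_compact _ _ _ _) /(_ cB) :
    {within [set v : 'rV[R]_(m * n) | `|v| <= r], continuous (vec_mx : 'rV[R]_(m * n) -> 'M[R]_(m, n))}.
  apply: continuous_subspaceT => v; apply: (@cvg_mx R _ _ (nbhs_filter v)) => i j.
  under eq_cvg do rewrite mxE.
  rewrite mxE; exact: coord_continuous.
congr compact; apply/seteqP; split=> [_ [v /= vr <-]|M /= Mr].
  apply/mx_norm_leP => // i j; rewrite mxE.
  exact: le_trans (mx_norm_coord _ _ _) vr.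
exists (mxvec M); last exact: mxvecK.
apply/mx_norm_leP => // i k; rewrite ord1; case/mxvec_indexP: k => i' j'.
rewrite mxvecE; exact: le_trans (mx_norm_coord _ _ _) Mr.
Qed.

Lemma compact_mx_bounded (K : set V) : compact K ->
  exists2 r : R, 0 <= r & forall x, K x -> `|x| <= r.
Proof.
move=> /compact_bounded[r [_ H]]; exists (`|r| + 1) => [|x]; first by rewrite addr_ge0.
by apply: H; rewrite ltr_pwDr// ler_norm.
Qed.

End Estimates.

(** * Composition with a net of matrices *)
Section NetPullback.
Variables (R : realType) (d : nat).
Local Notation epsI := (epsI R).
Local Notation V := 'cV[R]_d.
Local Notation C := (Rcomplex R).
Implicit Types (u : net R d) (A : epsI -> 'M[R]_d) (K : set V) (s : seq 'I_d).

Definition net_pullback A u : net R d := fun e => pullback (A e) (u e).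

Definition eventually_bounded A :=
  exists c e1 : R, 0 < e1 /\ forall e, val e < e1 -> `|A e| <= c.

Lemma moderate_partial u j : moderate u -> moderate (fun e => partial j (u e)).
Proof.
move=> /moderateP[su mu]; apply/moderateP; split=> [e|K s cK].
  exact: smooth_partial.
have [b Hb] := mu K (rcons s j) cK; exists b.
by apply: uniformO_le Hb => e x _; rewrite partials_rcons.
Qed.

Lemma mulmx_in_ball (B : 'M[R]_d) (x : V) c r :
  `|B| <= c -> `|x| <= r -> `|B *m x| <= d%:R * c * r.
Proof.
move=> Bc xr; apply: le_trans (mulmx_norm _ _) _.
by apply: ler_pM; rewrite ?mulr_ge0 ?ler_wpM2l.
Qed.

Lemma moderate_pullback A u : moderate u -> eventually_bounded A ->
  moderate (net_pullback A u).
Proof.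
move=> /moderateP[su mu] [c [e1 [e10 Ac]]]; apply/moderateP.
split=> [e|K s cK]; first exact: smooth_pullback.
have [r r0 Kr] := compact_mx_bounded cK.
have cB := @compact_mx_ball R d 1 (d%:R * c * r).
have [b Hb] := common_order (size s) (fun s => mu _ s cB).
exists b; apply: (uniformO_eventually e10).
apply: (partials_pullback_estimate (A := fun e _ => A e) (x := fun _ x => x)
  (c := c) su _ Hb) => e x [/Ac ? /Kr ?]; split=> //.
exact: mulmx_in_ball.
Qed.

Lemma bigO_uniformO T (Q : epsI -> set T) (x : epsI -> R) b :
  bigO (fun e => (x e)%:E) b -> uniformO Q (fun e _ => x e) b.
Proof.
move=> [M [e0 [e00 H]]]; exists M, e0; split=> // e t ee0 _.
by rewrite -lee_fin; exact: H.
Qed.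

Lemma ball_segment r (x y : V) t : `|x| <= r -> `|y| <= r -> 0 < t < 1 ->
  `|x + t *: (y - x)| <= r.
Proof.
move=> xr yr /andP[t0 t1].
have -> : x + t *: (y - x) = (1 - t) *: x + t *: y.
  by rewrite scalerBr scalerBl scale1r addrA addrAC.
apply: le_trans (ler_normD _ _) _; rewrite !normrZ (gtr0_norm t0).
rewrite gtr0_norm ?subr_gt0//.
apply: (@le_trans _ _ ((1 - t) * r + t * r)).
  by apply: lerD; apply: ler_wpM2l => //; rewrite ?subr_ge0 ltW.
by rewrite -mulrDl subrK mul1r.
Qed.

(** Composition depends only on the class of the net of matrices. Without
    derivatives this is the mean value inequality, the moderate growth of the
    first derivatives being absorbed by the negligible [A e - A' e]; the chain
    rule adds terms in which [A e - A' e] multiplies a moderate net. *)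
Lemma pullback_close A A' u K s b : moderate u ->
  eventually_bounded A -> eventually_bounded A' ->
  (forall b', bigO (fun e => `|A e - A' e|%:E) b') -> compact K ->
  uniformO (fun _ => K) (fun e x =>
    `|partials s (pullback (A e) (u e)) x - partials s (pullback (A' e) (u e)) x|) b.
Proof.
move=> mu [c [e1 [e10 Ac]]] [c' [e1' [e10' Ac']]] AA' cK.
have [r r0 Kr] := compact_mx_bounded cK.
pose m := Num.max c c'.
apply: (@uniformO_eventually _ _ _ _ _ (Num.min e1 e1')).
  by rewrite lt_min e10.
set Q := (X in uniformO X).
have QA e x : Q e x -> [/\ `|A e| <= m, `|A' e| <= m, `|x| <= r & K x].
  rewrite /Q lt_min => -[/andP[/Ac ? /Ac' ?] Kx].
  by rewrite !le_max; split=> //; [apply/orP; left|apply/orP; right|exact: Kr].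
elim/last_ind: s u mu b => [|s i IHs] u mu b.
  (* A ball is used because it is convex: it contains the segments between
     [A e *m x] and [A' e *m x]. *)
  have [su /(_ _ _ (@compact_mx_ball R d 1 (d%:R * m * r)))] := iffLR (moderateP u) mu.
  move=> /(common_order 1)[b0 Hb].
  have [M [e2 [e20 HM]]] := uniformO_sum (index_enum 'I_d)
    (fun j => Hb [:: j] erefl).
  apply: (uniformO_eventually e20).
  have H1 : uniformO (fun e t => val e < e2 /\ Q e t)
      (fun e _ => `|A e - A' e| * (`|M| * val e `^ b0)) b.
    rewrite -[b in uniformO _ _ b](subrK b0); apply: uniformOM.
    - by [].
    - by move=> e _ _; rewrite mulr_ge0// powR_ge0.
    - exact: bigO_uniformO.
    - by exists `|M|, 1.
  apply: uniformO_le (uniformOZ (k := 2 * d%:R * d%:R * r) _ H1); last first.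
    by rewrite !mulr_ge0.
  move=> e x [ee2 /QA[Am A'm xr _]] /=.
  have bound j t : 0 < t < 1 ->
      `|partial j (u e) (A' e *m x + t *: (A e *m x - A' e *m x))| <=
      `|M| * val e `^ b0.
    move=> t01; set y := _ + _.
    have yr : `|y| <= d%:R * m * r.
      by apply: ball_segment => //; exact: mulmx_in_ball.
    apply: le_trans (ler_wpM2r (powR_ge0 _ _) (ler_norm M)).
    apply: le_trans (HM e y ee2 yr); rewrite (bigD1 j)//= lerDl.
    by apply: sumr_ge0 => k _.
  apply: le_trans (mean_value_bound (fun z => smooth_diff z (su e)) bound) _.
  have -> : 2 * d%:R * d%:R * r * (`|A e - A' e| * (`|M| * val e `^ b0)) =
      2 * (d%:R * (d%:R * `|A e - A' e| * r) * (`|M| * val e `^ b0)) by ring.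
  rewrite ler_wpM2l// ler_wpM2r ?mulr_ge0 ?powR_ge0// ler_wpM2l// -mulmxBl.
  by apply: le_trans (mulmx_norm _ _) _; rewrite ler_wpM2l ?mulr_ge0.
have [su _] := iffLR (moderateP u) mu.
have mj j := moderate_partial j mu.
have H2 j : uniformO Q (fun e x => m *
    `|partials s (pullback (A e) (partial j (u e))) x -
      partials s (pullback (A' e) (partial j (u e))) x| +
    `|A e - A' e| * `|partials s (pullback (A' e) (partial j (u e))) x|) b.
  apply: uniformOD.
    case: (ltP m 0) => [m0|m0]; last by apply: uniformOZ => //; exact: IHs.
    exists 0, 1; split=> // e x _ /QA[/(le_trans (normr_ge0 _))].
    by rewrite leNgt m0.
  have bA' : eventually_bounded A' by exists c', e1'.
  have [_ /(_ _ s cK)[b0 Hb0]] := iffLR (moderateP _) (moderate_pullback (mj j) bA').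
  (* The order [b - b0] of [A e - A' e] compensates the order [b0] of the
     moderate factor. *)
  rewrite -[b in uniformO _ _ b](subrK b0); apply: uniformOM => //.
    exact: bigO_uniformO.
  apply: (uniformO_reindex (h := fun _ x => x) _ Hb0) => e x.
  by move=> /QA[].
apply: uniformO_le (uniformO_sum (index_enum _) H2) => e x /QA[Am A'm _ _].
rewrite !partials_rcons_pullback// !fct_sumE -sumrB.
apply: le_trans (ler_norm_sum _ _ _) _; apply: ler_sum => j _.
set P := partials s _; set P' := partials s _.
have -> : A e j i *: P x - A' e j i *: P' x =
    A e j i *: (P x - P' x) + (A e j i - A' e j i) *: P' x.
  by rewrite scalerBr scalerBl addrA subrK.
apply: le_trans (ler_normD _ _) _; rewrite !normrZ; apply: lerD.
  by apply: ler_wpM2r => //; apply: le_trans Am; exact: mx_norm_coord.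
apply: ler_wpM2r => //.
by have := mx_norm_coord (A e - A' e) j i; rewrite !mxE.
Qed.

End NetPullback.

(** * Approximate isometries are close to isometries *)
Section NearOrthogonal.
Variable R : realType.

Lemma norm_trmx m n (M : 'M[R]_(m, n)) : `|M^T| <= `|M|.
Proof. by apply/mx_norm_leP => // i j; rewrite mxE; exact: mx_norm_coord. Qed.

Lemma norm_block_mx m1 m2 n1 n2 (Aul : 'M[R]_(m1, n1)) (Aur : 'M[R]_(m1, n2))
    (Adl : 'M[R]_(m2, n1)) (Adr : 'M[R]_(m2, n2)) t :
  `|Aul| <= t -> `|Aur| <= t -> `|Adl| <= t -> `|Adr| <= t ->
  `|block_mx Aul Aur Adl Adr| <= t.
Proof.
move=> ul ur dl dr; apply/mx_norm_leP => [|i j]; first exact: le_trans ul.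
case: (split_ordP i) => i' ->; case: (split_ordP j) => j' ->.
- by rewrite block_mxEul; exact: le_trans (mx_norm_coord _ _ _) ul.
- by rewrite block_mxEur; exact: le_trans (mx_norm_coord _ _ _) ur.
- by rewrite block_mxEdl; exact: le_trans (mx_norm_coord _ _ _) dl.
- by rewrite block_mxEdr; exact: le_trans (mx_norm_coord _ _ _) dr.
Qed.

Lemma norm_scalar_mx n (a : R) : `|a%:M : 'M[R]_n| <= `|a|.
Proof.
apply/mx_norm_leP => // i j; rewrite mxE; case: (i == j) => //=.
by rewrite mulr0n normr0.
Qed.

(** The case of dimension 1: [s] is the square root of [`|b + a|^-1], and
    [`|s - 1| <= `|s ^+ 2 - 1|]. *)
Lemma scalar_normalize (b a : R) : b = 1 \/ b = -1 -> `|a| <= 2^-1 ->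
  [/\ b + a != 0, `|(b + a)^-1| <= 2 & exists s,
    s * (b + a) * s = b /\ `|s - 1| <= 2 * `|a| ].
Proof.
move=> b1 a2.
have nb : `|b| = 1 by case: b1 => ->; rewrite ?normrN normr1.
have ba : 2^-1 <= `|b + a|.
  have := lerB_normD b a; rewrite nb; apply: le_trans; lra.
have ba0 : 0 < `|b + a| by apply: lt_le_trans ba; rewrite invr_gt0.
have iba : `|(b + a)^-1| <= 2.
  by rewrite normfV -[leRHS]invrK lef_pV2 ?posrE ?invr_gt0.
split=> //; first by rewrite -normr_gt0.
exists (Num.sqrt `|b + a|^-1); set s := Num.sqrt _.
have s0 : 0 <= s by exact: sqrtr_ge0.
have ss : s ^+ 2 = `|b + a|^-1 by rewrite sqr_sqrtr// invr_ge0.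
split.
  rewrite mulrAC -expr2 ss; move: a2; rewrite ler_norml => /andP[a1 a2].
  case: b1 => ->.
    have p : 0 < 1 + a by lra.
    by rewrite gtr0_norm// mulVf// gt_eqF.
  have p : -1 + a < 0 by lra.
  by rewrite ltr0_norm// invrN mulNr mulVf// lt_eqF.
apply: (@le_trans _ _ (`|s ^+ 2 - 1|)).
  rewrite subr_sqr_1 normrM ler_peMr// ger0_norm ?addr_ge0//.
  by rewrite lerDr.
have -> : s ^+ 2 - 1 = `|b + a|^-1 * (1 - `|b + a|).
  by rewrite ss mulrBr mulVf ?mulr1// gt_eqF.
rewrite normrM normfV normr_id -normfV; apply: ler_pM => //.
rewrite -nb; apply: le_trans (ler_dist_dist _ _) _.
by rewrite opprD addNKr normrN.
Qed.

(** A symmetric matrix close to a diagonal matrix of signs is congruent to it,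
    through a matrix that is close to the identity at a linear rate. This is the
    Gram-Schmidt process: the first basis vector is normalized and the others
    are made orthogonal to it, which leaves a Schur complement of size [n] that
    satisfies the same hypotheses with the perturbation at most doubled. *)
Lemma near_congruence n : exists c delta : R, [/\ 0 <= c, 0 < delta &
  forall (b : 'rV[R]_n) (N : 'M[R]_n),
    (forall i, b 0 i = 1 \/ b 0 i = -1) -> N^T = N -> `|N| <= delta ->
    exists X : 'M[R]_n, X^T *m (diag_mx b + N) *m X = diag_mx b /\
      `|X - 1%:M| <= c * `|N| ].
Proof.
elim: n => [|n [c' [delta' [c'0 d'0 IH]]]].
  exists 0, 1; split=> // b N _ _ _; exists 1%:M; split.
    by apply/matrixP => -[].
  by rewrite subrr normr0 mul0r.
exists (2 + 2 * c' + n%:R * 2 * (1 + c')), (Num.min 2^-1 (delta' / 2)).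
have c0 : 0 <= n%:R * 2 * (1 + c') by rewrite !mulr_ge0// addr_ge0.
split.
- by rewrite !addr_ge0// mulr_ge0.
- by rewrite lt_min invr_gt0 divr_gt0//= ltr0n.
move=> b N b1 NT; rewrite le_min => /andP[N2 Nd].
rewrite -[n.+1]/(1 + n)%N in b N b1 NT N2 Nd *.
set eta := `|N| in N2 Nd *.
have eta0 : 0 <= eta by exact: normr_ge0.
pose a := ulsubmx N 0 0; pose v := ursubmx N; pose N' := drsubmx N.
pose b0 := b 0 (lshift n 0); pose b' := rsubmx b.
have NE : N = block_mx a%:M v v^T N'.
  by rewrite /a -mx11_scalar /v trmx_ursub NT submxK.
have bE : diag_mx b = block_mx b0%:M 0 0 (diag_mx b').
  rewrite -[b in LHS]hsubmxK diag_mx_row; congr block_mx.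
  by apply/matrixP => i j; rewrite !mxE !ord1.
have ae : `|a| <= eta by rewrite /a !mxE; exact: mx_norm_coord.
have ve : `|v| <= eta.
  by apply/mx_norm_leP => // i j; rewrite !mxE; exact: mx_norm_coord.
have N'e : `|N'| <= eta.
  by apply/mx_norm_leP => // i j; rewrite !mxE; exact: mx_norm_coord.
have [beta0 beta2 [s [sbs s1]]] :=
  scalar_normalize (b1 (lshift n 0)) (le_trans ae N2).
rewrite -/b0 in beta0 beta2 sbs; set beta := b0 + a in beta0 beta2 sbs.
(* [s] normalizes the first vector, [w] removes the first component of the
   others, and [N''] is the perturbation in the Schur complement. *)
pose w := - beta^-1 *: v.
have we : `|w| <= 2 * eta.
  by rewrite normrZ normrN; apply: ler_pM.
have wv : beta *: w + v = 0.
  by rewrite scalerA mulrN divff// scaleN1r addNr.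
pose N'' := N' + v^T *m w.
have N''T : N''^T = N''.
  rewrite /N'' linearD/= trmx_mul trmxK /w linearZ/= -scalemxAl -scalemxAr.
  by congr (_ + _); rewrite /N' trmx_drsub NT.
have N''e : `|N''| <= 2 * eta.
  rewrite mulr_natl mulr2n; apply: le_trans (ler_normD _ _) _; apply: lerD => //.
  apply: le_trans (mulmx_norm _ _) _; rewrite mul1r.
  apply: (@le_trans _ _ (eta * (2 * eta))).
    by apply: ler_pM => //; exact: le_trans (norm_trmx _) ve.
  by rewrite -[leRHS]mulr1 ler_wpM2l//; lra.
have N''d : `|N''| <= delta'.
  by apply: le_trans N''e _; rewrite mulrC -ler_pdivlMr.
have [|X' [X'E X'1]] := IH b' N'' _ N''T N''d.
  by move=> i; rewrite /b' mxE; exact: b1.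
exists (block_mx s%:M (w *m X') 0 X'); split.
  rewrite bE [N in LHS]NE add_block_mx !add0r -raddfD/= -/beta.
  rewrite tr_block_mx trmx0 tr_scalar_mx !mulmx_block.
  rewrite !mul0mx !mulmx0 !addr0 ?add0r.
  have wvT : w^T *m beta%:M + v^T = 0.
    by rewrite mul_mx_scalar -linearZ -linearD/= wv trmx0.
  have -> : (w *m X')^T *m beta%:M + X'^T *m v^T = 0.
    by rewrite trmx_mul -mulmxA -mulmxDr wvT mulmx0.
  rewrite !mul0mx add0r; congr block_mx.
  - by rewrite -!scalar_mxM sbs.
  - transitivity (s%:M *m ((beta%:M *m w + v) *m X')).
      by rewrite mulmxDl mulmxDr !mulmxA.
    by rewrite (mul_scalar_mx beta w) wv mul0mx mulmx0.
  - have -> : (w *m X')^T *m v = X'^T *m (v^T *m w).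
      rewrite trmx_mul -mulmxA; congr mulmx.
      by rewrite /w linearZ/= -scalemxAl -scalemxAr.
    by rewrite -mulmxDr addrC -addrA -/N''.
have X'2 : `|X' - 1%:M| <= 2 * c' * eta.
  by apply: le_trans X'1 _; rewrite [leRHS]mulrAC [leRHS]mulrC ler_wpM2l.
have X'n : `|X'| <= 1 + c'.
  rewrite -[X'](subrK 1%:M) addrC; apply: le_trans (ler_normD _ _) _.
  apply: lerD; first by apply: le_trans (norm_scalar_mx _ _) _; rewrite normr1.
  apply: le_trans X'2 _; rewrite mulrAC -[leRHS]mul1r ler_wpM2r//; lra.
have c'e : 0 <= c' * eta by exact: mulr_ge0.
set k := n%:R * 2 * (1 + c') in c0 *.
have ke : 0 <= k * eta by exact: mulr_ge0.
rewrite (scalar_mx_block 1 n 1) opp_block_mx add_block_mx oppr0 !addr0.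
apply: norm_block_mx.
- rewrite -raddfB/=; apply: le_trans (norm_scalar_mx _ _) _.
  apply: le_trans s1 _; lra.
- apply: (@le_trans _ _ (k * eta)); last lra.
  apply: le_trans (mulmx_norm _ _) _.
  have -> : k * eta = n%:R * (2 * eta) * (1 + c') by rewrite /k; ring.
  by apply: ler_pM; rewrite ?mulr_ge0 ?ler_wpM2l.
- rewrite subr0 normr0; lra.
- apply: le_trans X'2 _; lra.
Qed.

Lemma Bmx_sign d p : exists2 b : 'rV[R]_d,
  Bmx R d p = diag_mx b & forall i, b 0 i = 1 \/ b 0 i = -1.
Proof.
exists (\row_(i < d) if (i < p)%N then 1 else -1) => // i.
by rewrite mxE; case: ifP => _; [left|right].
Qed.

(** If [A] nearly preserves the form, then [A *m X] preserves it, with the [X]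
    given by [near_congruence]. The linear rate is essential: it turns a
    negligible defect into a negligible correction. *)
Lemma near_Opq d p : exists c delta : R, [/\ 0 <= c, 0 < delta &
  forall A : 'M[R]_d, `|A^T *m Bmx R d p *m A - Bmx R d p| <= delta ->
    exists2 A' : 'M[R]_d, Opq R d p A' &
      `|A - A'| <= c * `|A| * `|A^T *m Bmx R d p *m A - Bmx R d p|].
Proof.
have [b bE b1] := Bmx_sign d p.
have [c [delta [c0 d0 H]]] := near_congruence d.
exists (d%:R * c), delta; split=> //; first by rewrite mulr_ge0.
move=> A; rewrite bE; set N := _ - _ => Nd.
have NT : N^T = N.
  by rewrite /N linearB/= !trmx_mul trmxK tr_diag_mx mulmxA.
have [X [XE X1]] := H b N b1 NT Nd.
exists (A *m X).
  rewrite /Opq/= bE trmx_mul; transitivity (X^T *m (A^T *m diag_mx b *m A) *m X).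
    by rewrite !mulmxA.
  by rewrite -[RHS]XE /N addrC subrK.
rewrite -normrN opprB -{2}[A]mulmx1 -mulmxBr.
apply: le_trans (mulmx_norm _ _) _.
have -> : d%:R * c * `|A| * `|N| = d%:R * `|A| * (c * `|N|) by ring.
by rewrite ler_wpM2l// mulr_ge0.
Qed.

End NearOrthogonal.

(** * Baire category in a closed set of matrices *)
Section ClosedBaire.
Variables (R : realType) (m n : nat).
Local Notation M := 'M[R]_(m, n).

(** The inductive step of the Baire argument. *)
Lemma shrink_ball (a x : M) (r : R) (F : set M) (e : R) : 0 < e ->
  closed F -> ~ F x -> `|a - x| < r -> exists2 r', 0 < r' <= e &
    forall y, `|x - y| <= r' -> `|a - y| <= r /\ ~ F y.
Proof.
move=> e0 cF nFx axr.
have /nbhs_ballP[rho /= rho0 H] : nbhs x (~` F).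
  by apply: open_nbhs_nbhs; split => //; exact: closed_openC.
have r0 : 0 < r - `|a - x| by rewrite subr_gt0.
exists (Num.min e (Num.min (rho / 2) (r - `|a - x|))).
  by rewrite !lt_min e0 r0 divr_gt0//= ge_min lexx.
move=> y; rewrite !le_min => /and3P[_ xyrho xyr]; split.
  rewrite -(subrK x a) -addrA; apply: le_trans (ler_normD _ _) _.
  by rewrite -lerBrDl.
apply: H; rewrite -ball_normE /=; apply: le_lt_trans xyrho _.
by rewrite ltr_pdivrMr// ltr_pMr// ltr1n.
Qed.

(** The Baire category theorem in a closed set [G] of matrices. If no [F k]
    contained a relatively open ball of [G], then one could choose nested balls
    centered in [G], with radii tending to 0, the [k]-th choice avoiding [F k];
    the limit of the centers would lie in [G] and in none of the [F k]. *)
Lemma closed_Baire (G : set M) (F : nat -> set M) :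
  closed G -> G !=set0 -> (forall k, closed (F k)) ->
  (forall x, G x -> exists k, F k x) ->
  exists k a r, [/\ 0 < r, G a & forall x, G x -> `|a - x| < r -> F k x].
Proof.
move=> cG [a0 Ga0] cF GF; apply: contrapT => noball.
have esc k a r : 0 < r -> G a -> exists x, [/\ G x, `|a - x| < r & ~ F k x].
  move=> r0 Ga; apply: contrapT => H; apply: noball; exists k, a, r.
  split=> // x Gx ax; apply: contrapT => nF; apply: H.
  by exists x.
have step (q : nat * (M * R)) : exists q' : M * R, G q.2.1 -> 0 < q.2.2 ->
    [/\ G q'.1, 0 < q'.2 <= q.1.+1%:R^-1 &
    forall y, `|q'.1 - y| <= q'.2 -> `|q.2.1 - y| <= q.2.2 /\ ~ F q.1 y].
  case: q => k [a r] /=.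
  have [[Ga r0]|H] := pselect (G a /\ 0 < r); last first.
    by exists (a, r) => Ga r0; exfalso; apply: H.
  have [x [Gx axr nFx]] := esc k a r r0 Ga.
  have e0 : 0 < k.+1%:R^-1 :> R by rewrite invr_gt0.
  have [r' r'0 H] := shrink_ball e0 (cF k) nFx axr.
  by exists (x, r').
have [f Hf] := choice step.
pose fix c k := if k is j.+1 then f (j, c j) else (a0, 1).
pose a k := (c k).1; pose r k := (c k).2.
have inv k : G (a k) /\ 0 < r k.
  elim: k => [|k [Gk rk]]; first by split; [|exact: ltr01].
  by have [? /andP[? _] _] := Hf (k, c k) Gk rk.
have next k y : `|a k.+1 - y| <= r k.+1 -> `|a k - y| <= r k /\ ~ F k y.
  by have [Gk rk] := inv k; have [_ _] := Hf (k, c k) Gk rk; exact.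
have small k : r k.+1 <= k.+1%:R^-1.
  by have [Gk rk] := inv k; have [_ /andP[_]] := Hf (k, c k) Gk rk.
have nested j k y : (j <= k)%N -> `|a k - y| <= r k -> `|a j - y| <= r j.
  elim: k => [|k IHk]; first by rewrite leqn0 => /eqP ->.
  rewrite leq_eqVlt => /orP[/eqP->//|jk /next[+ _]].
  exact: IHk.
have near_a j k : (j <= k)%N -> `|a j - a k| <= r j.
  by move=> jk; apply: (nested _ _ _ jk); rewrite subrr normr0 ltW// (inv k).2.
have : cvg (a @ \oo).
  apply: cauchy_cvg; apply: cauchy_exP => e e0.
  near \oo => k; exists (a k.+1), k.+1 => // j kj.
  rewrite /= -ball_normE /=; apply: le_lt_trans (near_a _ _ kj) _.
  apply: le_lt_trans (small k) _; near: k.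
  exact: (near_infty_natSinv_lt (PosNum e0)).
rewrite cvg_ex => -[l al].
have al_le k : `|a k - l| <= r k.
  apply/ler_addgt0Pr => e e0.
  have /(@cvgrPdist_lt _ _ _ (nbhs \oo)) /(_ _ e0) H := al.
  near \oo => j.
  have kj : (k <= j)%N by near: j; exact: nbhs_infty_ge.
  rewrite -(subrK (a j) (a k)) -addrA; apply: le_trans (ler_normD _ _) _.
  apply: lerD; first exact: near_a.
  by rewrite distrC ltW//; near: j.
have [k Fkl] : exists k, F k l.
  apply: GF; apply: (closed_cvg _ cG _ _ al).
  by apply: nearW => k; have [] := inv k.
by have [_] := next k l (al_le k.+1).
Unshelve. all: by end_near. Qed.

End ClosedBaire.

(** * The group O(p,q) *)
Section OrthogonalGroup.
Variables (R : realType) (d p : nat).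
Local Notation G := (Opq R d p).
Local Notation B := (Bmx R d p).

Lemma Bmx_sqr : B *m B = 1%:M.
Proof.
have [b -> b1] := Bmx_sign R d p; rewrite mulmx_diag.
apply/matrixP => i j; rewrite !mxE; congr (_ *+ _).
by case: (b1 i) => ->; rewrite ?mulrNN mulr1.
Qed.

Lemma Opq1 : G 1%:M.
Proof. by rewrite /Opq/= trmx1 mul1mx mulmx1. Qed.

Lemma OpqM A1 A2 : G A1 -> G A2 -> G (A1 *m A2).
Proof.
rewrite /Opq/= trmx_mul => A1B A2B.
transitivity (A2^T *m (A1^T *m B *m A1) *m A2); last by rewrite A1B.
by rewrite !mulmxA.
Qed.

(** The inverse of [A] when [A] preserves the form, as [A^T *m B *m A = B] and
    [B *m B = 1]. *)
Definition Opq_inv (A : 'M[R]_d) := B *m A^T *m B.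

Lemma Opq_invK A : G A -> Opq_inv A *m A = 1%:M.
Proof. by rewrite /Opq/= /Opq_inv -!mulmxA => ->; exact: Bmx_sqr. Qed.

Lemma Opq_invKV A : G A -> A *m Opq_inv A = 1%:M.
Proof. by move=> /Opq_invK; exact: mulmx1C. Qed.

Lemma Opq_invP A : G A -> G (Opq_inv A).
Proof.
move=> GA; have BT : B^T = B by exact: tr_diag_mx.
have E : A *m B *m A^T = B.
  have := Opq_invKV GA; rewrite /Opq_inv !mulmxA => E.
  by rewrite -[LHS]mulmx1 -Bmx_sqr !mulmxA E mul1mx.
rewrite /Opq/= /Opq_inv !trmx_mul trmxK BT.
transitivity (B *m (A *m (B *m B) *m B *m A^T) *m B); first by rewrite !mulmxA.
by rewrite Bmx_sqr mulmx1 E Bmx_sqr mul1mx.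
Qed.

Lemma closed_Opq : closed G.
Proof.
pose F (A : 'M[R]_d) := A^T *m B *m A.
have cF : continuous F.
  move=> A; apply: (@cvg_mulmx _ _ _ (nbhs_filter A) _ _ _ (fun A => A^T *m B) id) => //.
  apply: (@cvg_mulmx _ _ _ (nbhs_filter A) _ _ _ trmx (cst B)); last first.
    exact: (@cvg_cst _ B _ (nbhs A) (nbhs_filter A)).
  apply: (@cvg_mx R _ _ (nbhs_filter A)) => i j.
  under eq_cvg do rewrite mxE.
  rewrite mxE; exact: coord_continuous.
apply: (preimage_closed (fun A _ => cF A) (D := [set B])).
exact/accessible_closed_set1/hausdorff_accessible/norm_hausdorff.
Qed.

End OrthogonalGroup.

(** * Uniform invariance on bounded parts of O(p,q) *)
Section UniformInvariance.
Variables (R : realType) (d p : nat) (f : net R d).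
Local Notation epsI := (epsI R).
Local Notation V := 'cV[R]_d.
Local Notation G := (Opq R d p).

Hypothesis sf : forall e, smooth (f e).
Hypothesis invf : forall A, G A -> negligible (fun e => pullback A (f e) - f e).

Variables (K : set V) (s : seq 'I_d) (b : R).
Hypothesis cK : compact K.

(** Both the constant and the range of [e] in the estimate are governed by the
    single integer [k], so that each matrix of the group belongs to all levels
    from some rank on. *)
Definition invariance_level (k : nat) : set 'M[R]_d :=
  [set A | forall e, val e < k.+1%:R^-1 -> forall x, K x ->
    `|partials s (pullback A (f e) - f e) x| <= k%:R * val e `^ b].

Lemma closed_invariance_level k : closed (invariance_level k).
Proof.
have -> : invariance_level k =
    \bigcap_(ex in [set ex : epsI * V | val ex.1 < k.+1%:R^-1 /\ K ex.2])
    [set A | `|partials s (pullback A (f ex.1) - f ex.1) ex.2| <=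
             k%:R * val ex.1 `^ b].
  apply/seteqP; split=> [A HA [e x] /= [ek Kx]|A HA e ek x Kx]; first exact: HA.
  exact: (HA (e, x)).
apply: closed_bigI => -[e x] _ /=.
apply: (preimage_closed (f := fun A => `|partials s (pullback A (f e) - f e) x|)
  _ (@closed_le _ _)) => A _.
have E A' : partials s (pullback A' (f e) - f e) x =
    partials s (pullback A' (f e)) x - partials s (f e) x.
  by rewrite partialsB//; exact: smooth_pullback.
rewrite /continuous_at; under eq_cvg do rewrite E; rewrite E.
apply: (@cvg_norm _ _ _ (nbhs A) (nbhs_filter A)).
apply: (@cvgB _ _ _ (nbhs A) (nbhs_filter A)).
  exact: continuous_partials_pullback.
exact: (@cvg_cst _ _ _ (nbhs A) (nbhs_filter A)).
Qed.

Lemma near_levels (C e0 : R) : 0 < e0 ->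
  \forall k \near \oo, C <= k%:R /\ k.+1%:R^-1 <= e0.
Proof.
move=> e00; near=> k; split; first by near: k; exact: nbhs_infty_ger.
apply/ltW; near: k; exact: (near_infty_natSinv_lt (PosNum e00)).
Unshelve. all: by end_near. Qed.

Lemma in_level (A : 'M[R]_d) (C e0 : R) k : C <= k%:R -> k.+1%:R^-1 <= e0 ->
  (forall e x, val e < e0 -> K x ->
     `|partials s (pullback A (f e) - f e) x| <= C * val e `^ b) ->
  invariance_level k A.
Proof.
move=> Ck ke H e ek x Kx; apply: le_trans (H _ _ (lt_le_trans ek ke) Kx) _.
by rewrite ler_wpM2r// powR_ge0.
Qed.

(** The invariance under each single matrix says that the closed sets
    [invariance_level k] cover the group: by Baire, one of them contains a
    neighborhood of some [A0]. *)
Lemma local_uniformity : exists k A0 r, [/\ 0 < r, G A0 &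
  forall A, G A -> `|A0 - A| < r -> invariance_level k A].
Proof.
apply: closed_Baire.
- exact: closed_Opq.
- by exists 1%:M; exact: Opq1.
- exact: closed_invariance_level.
move=> A GA; have [_ /(_ K s b cK)[C [e0 [e00 H]]]] := iffLR (negligibleP _) (invf GA).
near \oo => k; exists k.
have [Ck ke] : C <= k%:R /\ k.+1%:R^-1 <= e0 by near: k; exact: near_levels.
by apply: (in_level Ck ke) => e x ee0; exact: H.
Unshelve. all: by end_near. Qed.

(** Uniformity is carried from [A0] to any [A1] by translation. With
    [T = A1 * A0^-1], a matrix [A] near [A1] is [T * A'] with [A'] near [A0], and
    [f o A - f = (f o T - f) o A' + (f o A' - f)]: the first term is negligible
    since [T] is a fixed matrix, uniformly for [A'] bounded, and the second one is
    controlled near [A0]. *)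
Lemma translated_uniformity A1 : G A1 -> exists r C e0, [/\ 0 < r, 0 < e0 &
  forall A, G A -> `|A1 - A| < r -> forall e x, val e < e0 -> K x ->
    `|partials s (pullback A (f e) - f e) x| <= C * val e `^ b].
Proof.
move=> GA1; have [k [A0 [r [r0 GA0 H0]]]] := local_uniformity.
pose T := A1 *m Opq_inv p A0; pose S := A0 *m Opq_inv p A1.
have GT : G T by apply: OpqM => //; exact: Opq_invP.
have GS : G S by apply: OpqM => //; exact: Opq_invP.
(* [S] is the inverse of [T], and [S *m A] is the [A'] above. *)
have TS : T *m S = 1%:M.
  rewrite /T /S mulmxA -[A1 *m _ *m _]mulmxA Opq_invK// mulmx1.
  exact: Opq_invKV.
have SA1 : S *m A1 = A0 by rewrite /S -mulmxA Opq_invK// mulmx1.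
have [rK rK0 KrK] := compact_mx_bounded cK.
pose c := `|A0| + r.
have [C [e0 [e00 HT]]] : uniformO
    (fun _ => [set t : 'M[R]_d * V | `|t.1| <= c /\ K t.2])
    (fun e t => `|partials s (pullback t.1 (pullback T (f e) - f e)) t.2|) b.
  have [sT nT] := iffLR (negligibleP _) (invf GT).
  apply: (partials_pullback_estimate (c := c)
    (K := [set x : V | `|x| <= d%:R * c * rK]) sT) => [e [A x] [/= Ac Kx]|s' _].
    by split=> //; apply: mulmx_in_ball => //; exact: KrK.
  exact/nT/compact_mx_ball.
have k0 : 0 < k.+1%:R^-1 :> R by rewrite invr_gt0.
have q0 : 0 < 1 + d%:R * `|S| by rewrite ltr_pwDl// mulr_ge0.
exists (r / (1 + d%:R * `|S|)), (C + k%:R), (Num.min e0 k.+1%:R^-1).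
split; [by rewrite divr_gt0|by rewrite lt_min e00|].
move=> A GA A1A e x; rewrite lt_min => /andP[ee0 ek] Kx.
have A'r : `|A0 - S *m A| < r.
  rewrite -SA1 -mulmxBr; apply: le_lt_trans (mulmx_norm _ _) _.
  apply: (@le_lt_trans _ _ ((1 + d%:R * `|S|) * `|A1 - A|)).
    by rewrite ler_wpM2r// lerDr.
  by rewrite mulrC -ltr_pdivlMr.
have GA' : G (S *m A) by exact: OpqM.
have -> : pullback A (f e) - f e = pullback (S *m A) (pullback T (f e) - f e) +
    (pullback (S *m A) (f e) - f e).
  rewrite pullbackB -pullbackM mulmxA TS mul1mx.
  by rewrite addrA subrK.
have sp M : smooth (pullback M (f e)) by exact: smooth_pullback.
rewrite partialsD; [|by apply: smooth_pullback; exact: smoothB|exact: smoothB].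
apply: le_trans (ler_normD _ _) _; rewrite mulrDl; apply: lerD.
  apply: (HT e (S *m A, x)) => //; split=> //=.
  rewrite -[S *m A](subrK A0) addrC; apply: le_trans (ler_normD _ _) _.
  by rewrite lerD2l distrC ltW.
exact: H0.
Qed.

(** A bounded part of the group is relatively compact, hence covered by finitely
    many of the neighborhoods of [translated_uniformity]. *)
Lemma compact_uniformity c : uniformO
  (fun _ => [set t : 'M[R]_d * V | [/\ G t.1, `|t.1| <= c & K t.2]])
  (fun e t => `|partials s (pullback t.1 (f e) - f e) t.2|) b.
Proof.
pose L := G `&` [set A : 'M[R]_d | `|A| <= c].
have cL : compact L.
  apply: (subclosed_compact _ (@compact_mx_ball R d d c)); last by move=> A [].
  apply: closedI; first exact: closed_Opq.
  apply: (preimage_closed (f := fun A : 'M[R]_d => `|A|) _ (@closed_le _ c)) => A _.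
  exact: norm_continuous.
have : \forall k \near \oo, L `<=` [set A | G A -> invariance_level k A].
  apply: (iffLR (compact_near_coveringP L) cL nat \oo
    (fun k A => G A -> invariance_level k A)) => A1 [GA1 _].
  have [r [C [e0 [r0 e00 H]]]] := translated_uniformity GA1.
  exists ([set A | `|A1 - A| < r], [set k | C <= k%:R /\ k.+1%:R^-1 <= e0]).
    split=> /=; last exact: near_levels.
    by apply/nbhs_ballP; exists r => // A; rewrite -ball_normE.
  move=> [A k] [/= A1A [Ck ke]] GA; apply: (in_level Ck ke) => e x ee0 Kx.
  exact: (H A GA A1A).
move=> Hk; near \oo => k.
exists k%:R, k.+1%:R^-1; split; first by rewrite invr_gt0.
move=> e [A x] ek [/= GA Ac Kx].
have : L `<=` [set A | G A -> invariance_level k A] by near: k.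
by apply.
Unshelve. all: by end_near. Qed.

End UniformInvariance.

(** * Representatives of generalized matrices *)
Section Representatives.
Variable R : realType.
Local Notation epsI := (epsI R).

(** [bnet_class], [bnet_eval] and [bnet_cst] are ring morphisms; they carry the
    matrix identity that defines [O(p, q)] between classes, nets, values at a
    given [e] and constants. *)
Definition bnet_class (x : bnet R) : Rtilde_c R := \pi_(Rtilde_c R) x.

Lemma bnet_class_is_zmod_morphism : zmod_morphism bnet_class.
Proof. by move=> x y; rewrite /bnet_class -!pi_is_zmod_morphism. Qed.

Lemma bnet_class_is_monoid_morphism : monoid_morphism bnet_class.
Proof.
exact: (pi_is_monoid_morphism (Quotient.quot (negligible_bnets (R := R)))).
Qed.

HB.instance Definition _ :=
  GRing.isZmodMorphism.Build (bnet R) (Rtilde_c R) bnet_class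
    bnet_class_is_zmod_morphism.
HB.instance Definition _ :=
  GRing.isMonoidMorphism.Build (bnet R) (Rtilde_c R) bnet_class
    bnet_class_is_monoid_morphism.

Definition bnet_eval (e : epsI) (x : bnet R) : R := bnet_val x e.

Lemma bnet_eval_is_zmod_morphism e : zmod_morphism (bnet_eval e).
Proof. by []. Qed.

Lemma bnet_eval_is_monoid_morphism e : monoid_morphism (bnet_eval e).
Proof. by []. Qed.

HB.instance Definition _ e :=
  GRing.isZmodMorphism.Build (bnet R) R (bnet_eval e)
    (bnet_eval_is_zmod_morphism e).
HB.instance Definition _ e :=
  GRing.isMonoidMorphism.Build (bnet R) R (bnet_eval e)
    (bnet_eval_is_monoid_morphism e).

Definition bnet_cst (r : R) : bnet R := Bnet (bounded_cst r).

Lemma bnet_cst_is_zmod_morphism : zmod_morphism bnet_cst.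
Proof. by move=> x y; apply: val_inj. Qed.

Lemma bnet_cst_is_monoid_morphism : monoid_morphism bnet_cst.
Proof. by split=> [|x y]; apply: val_inj. Qed.

HB.instance Definition _ :=
  GRing.isZmodMorphism.Build R (bnet R) bnet_cst bnet_cst_is_zmod_morphism.
HB.instance Definition _ :=
  GRing.isMonoidMorphism.Build R (bnet R) bnet_cst bnet_cst_is_monoid_morphism.

Lemma bnet_class_eq (x y : bnet R) : bnet_class x = bnet_class y ->
  forall b, bigO (fun e => `|bnet_val x e - bnet_val y e|%:E) b.
Proof.
move=> /eqP; rewrite /bnet_class -Quotient.idealrBE => /asboolP H b.
exact: H.
Qed.

Lemma map_Bmx (S T : comNzRingType) (g : {rmorphism S -> T}) d p :
  map_mx g (Bmx S d p) = Bmx T d p.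
Proof.
rewrite /Bmx map_diag_mx; congr diag_mx; apply/rowP => i; rewrite !mxE.
by case: ifP => _; rewrite ?rmorphN rmorph1.
Qed.

Lemma map_Opq (S T : comNzRingType) (g : {rmorphism S -> T}) d p (A : 'M[S]_d) :
  Opq S d p A -> Opq T d p (map_mx g A).
Proof.
rewrite /Opq/= => AB.
by rewrite -(map_Bmx g) matrix.map_trmx -!map_mxM AB.
Qed.

Section Matrices.
Variable d : nat.

Definition mx_rep (A : 'M[Rtilde_c R]_d) : 'M[bnet R]_d := map_mx repr A.

(** The net of matrices used by [comp_mx]. *)
Definition mx_net (A : 'M[Rtilde_c R]_d) (e : epsI) : 'M[R]_d :=
  \matrix_(i, j) bnet_val (repr (A i j)) e.

Lemma mx_repK A : map_mx bnet_class (mx_rep A) = A.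
Proof. by apply/matrixP => i j; rewrite !mxE /bnet_class reprK. Qed.

Lemma mx_net_eval A e : mx_net A e = map_mx (bnet_eval e) (mx_rep A).
Proof. by apply/matrixP => i j; rewrite !mxE. Qed.

Lemma norm_mx_le_sum m n (M : 'M[R]_(m, n)) :
  `|M| <= \sum_i \sum_j `|M i j|.
Proof.
apply/mx_norm_leP => [|i j]; first by do 2!apply: sumr_ge0 => ? _.
rewrite (bigD1 i)//= (bigD1 j)//= -addrA lerDl addr_ge0 ?sumr_ge0// => k _.
exact: sumr_ge0.
Qed.

Lemma bigO_mx m n (M : epsI -> 'M[R]_(m, n)) b :
  (forall i j, bigO (fun e => `|M e i j|%:E) b) -> bigO (fun e => `|M e|%:E) b.
Proof.
move=> H.
have /= H' i j :
    uniformO (fun _ (_ : unit) => True) (fun e _ => `|M e i j|) b.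
  exact: bigO_uniformO.
have [C [e0 [e00 HC]]] := uniformO_sum (index_enum 'I_m)
  (fun i => uniformO_sum (index_enum 'I_n) (H' i)).
exists C, e0; split=> // e ee0; rewrite lee_fin.
exact: le_trans (norm_mx_le_sum _) (HC e tt ee0 I).
Qed.

Lemma mx_net_bounded A : eventually_bounded (mx_net A).
Proof.
have H : bigO (fun e => `|mx_net A e|%:E) 0.
  apply: bigO_mx => i j.
  have [M [e0 [e00 HM]]] :=
    asboolW (valP (repr (A i j)) : bnet_val _ \in bounded_nets (R := R)).
  exists M, e0; split=> // e ee0.
  by rewrite mxE powRr0 mulr1 lee_fin; exact: HM.
have [M [e0 [e00 HM]]] := H; exists M, e0; split=> // e /HM.
by rewrite powRr0 mulr1 lee_fin.
Qed.

Lemma mx_net_Opq p A b : Opq (Rtilde_c R) d p A ->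
  bigO (fun e => `|(mx_net A e)^T *m Bmx R d p *m mx_net A e - Bmx R d p|%:E) b.
Proof.
rewrite /Opq/= => AB; apply: bigO_mx => i j.
pose N := (mx_rep A)^T *m Bmx (bnet R) d p *m mx_rep A.
have E e : (mx_net A e)^T *m Bmx R d p *m mx_net A e = map_mx (bnet_eval e) N.
  by rewrite mx_net_eval /N !map_mxM -matrix.map_trmx map_Bmx.
have NB : map_mx bnet_class N = map_mx bnet_class (Bmx (bnet R) d p).
  by rewrite /N !map_mxM -matrix.map_trmx map_Bmx mx_repK.
have /bnet_class_eq /(_ b) : bnet_class (N i j) = bnet_class (Bmx (bnet R) d p i j).
  by have /matrixP/(_ i j) := NB; rewrite !mxE.
apply: bigO_le => e; rewrite E -(map_Bmx (bnet_eval e)).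
by rewrite !mxE.
Qed.

Lemma mx_net_cst (A : 'M[R]_d) b :
  bigO (fun e => `|mx_net (map_mx (@Rtilde_cst R) A) e - A|%:E) b.
Proof.
apply: bigO_mx => i j.
have /bnet_class_eq /(_ b) : bnet_class (repr (Rtilde_cst (A i j))) =
    bnet_class (bnet_cst (A i j)) by rewrite /bnet_class reprK.
by apply: bigO_le => e; rewrite !mxE.
Qed.

End Matrices.

Lemma Opq_cst d p (A : 'M[R]_d) : Opq R d p A ->
  Opq (Rtilde_c R) d p (map_mx (@Rtilde_cst R) A).
Proof.
move=> /(map_Opq bnet_cst)/(map_Opq bnet_class); rewrite -map_mx_comp.
by congr Opq.
Qed.

End Representatives.

(** * Classes of composed nets *)
Section Classes.
Variables (R : realType) (d : nat).
Local Notation epsI := (epsI R).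
Implicit Types (f : colombeau R d) (A : 'M[Rtilde_c R]_d).

Definition colombeau_rep f : net R d := EM_val (repr f).

Lemma moderate_rep f : moderate (colombeau_rep f).
Proof.
exact: asboolW
  (valP (repr f) : colombeau_rep f \in moderate_nets (R := R) (d := d)).
Qed.

Lemma net_class_eqP (u : net R d) f : moderate u ->
  net_class u = f <-> negligible (u - colombeau_rep f).
Proof.
move=> mu; rewrite /net_class -{1}[f]reprK.
have vu : EM_val (insubd (0 : EM R d) u) = u.
  by apply: (@insubdK _ _ (EM R d)); apply/asboolP.
have E : EM_val (insubd 0 u - repr f) = u - colombeau_rep f by rewrite -{2}vu.
split=> [/eqP|nu].
  by rewrite -Quotient.idealrBE => /asboolP; rewrite /negligible_nets E.
by apply/eqP; rewrite -Quotient.idealrBE; apply/asboolP; rewrite E.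
Qed.

(** As [net_pullback (mx_net A)] preserves moderateness, invariance under [A] can
    be read on representatives. *)
Lemma comp_mx_eqP f A :
  comp_mx f A = f <->
  negligible (net_pullback (mx_net A) (colombeau_rep f) - colombeau_rep f).
Proof.
apply: net_class_eqP; apply: moderate_pullback; first exact: moderate_rep.
exact: mx_net_bounded.
Qed.

(** [u - f = (u - v) + (v - f)]. *)
Lemma negligible_close (f u v : net R d) : moderate f ->
  (forall e, smooth (u e)) -> (forall e, smooth (v e)) ->
  (forall K s b, compact K -> uniformO (fun _ => K)
    (fun e x => `|partials s (u e) x - partials s (v e) x|) b) ->
  negligible (v - f) -> negligible (u - f).
Proof.
move=> [sf _] su sv uv /negligibleP[_ nv]; apply/negligibleP; split=> [e|K s b cK].
  exact: smoothB.
apply: uniformO_le (uniformOD (uv K s b cK) (nv K s b cK)) => e x _.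
rewrite -[(u - f) e]/(u e - f e) -[(v - f) e]/(v e - f e) !partialsB//.
apply: le_trans (ler_normD _ _).
rewrite -[(partials s (u e) - _) x]/(_ - _) -[(partials s (v e) - _) x]/(_ - _).
by rewrite addrA subrK.
Qed.

Lemma bigO_small (x : epsI -> R) delta : 0 < delta ->
  bigO (fun e => (x e)%:E) 1 ->
  exists e0 : R, 0 < e0 /\ forall e, val e < e0 -> x e <= delta.
Proof.
move=> d0 [C [e0 [e00 H]]].
have C0 : 0 < `|C| + 1 by rewrite ltr_wpDl.
exists (Num.min e0 (delta / (`|C| + 1))); split=> [|e].
  by rewrite lt_min e00 divr_gt0.
rewrite lt_min ltr_pdivlMr// => /andP[/H]; rewrite lee_fin.
have /andP[ep _] := svalP e.
rewrite powRr1 ?(ltW ep)// => /le_trans xC /ltW eC; apply: xC.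
apply: le_trans eC; rewrite mulrC ler_wpM2l ?(ltW ep)//.
by rewrite ler_wpDr// ler_norm.
Qed.

(** The defect of a representative of [A] is negligible, hence small for small
    [e]; correcting it with [near_Opq] changes the representative by a negligible
    net. For the other values of [e] the correction is arbitrary. *)
Lemma exact_representative p A : Opq (Rtilde_c R) d p A ->
  exists A' : epsI -> 'M[R]_d, [/\ eventually_bounded A',
    forall b, bigO (fun e => `|mx_net A e - A' e|%:E) b &
    exists e0 : R, 0 < e0 /\ forall e, val e < e0 -> Opq R d p (A' e)].
Proof.
move=> AB; have [c [delta [c0 d0 H]]] := near_Opq R d p.
pose N e := (mx_net A e)^T *m Bmx R d p *m mx_net A e - Bmx R d p.
have ON b : bigO (fun e => `|N e|%:E) b := mx_net_Opq b AB.
have [e0 [e00 Hd]] := bigO_small d0 (ON 1).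
have [M [e1 [e10 HM]]] := mx_net_bounded A.
have ex e : exists A' : 'M[R]_d, `|N e| <= delta -> Opq R d p A' /\
    `|mx_net A e - A'| <= c * `|mx_net A e| * `|N e|.
  have [Nd|Nd] := pselect (`|N e| <= delta); last by exists 0.
  by have [A' ? ?] := H _ Nd; exists A'.
have [A' HA'] := choice ex.
have e20 : 0 < Num.min e0 e1 by rewrite lt_min e00.
have close e : val e < Num.min e0 e1 -> `|mx_net A e - A' e| <= c * M * `|N e|.
  rewrite lt_min => /andP[/Hd/HA'[_ cl] /HM AM].
  by apply: le_trans cl _; rewrite ler_wpM2r// ler_wpM2l.
exists A'; split.
- exists (M + c * M * delta), (Num.min e0 e1); split=> // e e2.
  rewrite -[A' e](subrK (mx_net A e)) addrC.
  apply: le_trans (ler_normD _ _) _; rewrite distrC.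
  have := e2; rewrite lt_min => /andP[/Hd Nd /HM AM].
  apply: lerD => //; apply: le_trans (close e e2) _.
  by rewrite ler_wpM2l// mulr_ge0// (le_trans _ AM).
- move=> b; have [C [e2 [e20' HC]]] := ON b.
  exists (c * M * C), (Num.min e2 (Num.min e0 e1)).
  split=> [|e]; first by rewrite lt_min e20'.
  rewrite [val e < _]lt_min => /andP[/HC + e2e]; rewrite !lee_fin => NC.
  apply: le_trans (close e e2e) _; rewrite -[leRHS]mulrA ler_wpM2l//.
  have := e2e; rewrite lt_min => /andP[_ /HM AM].
  by rewrite mulr_ge0// (le_trans _ AM).
- by exists e0; split=> // e /Hd/HA'[].
Qed.

End Classes.

Theorem mainTheorem4 (R : realType) (d p : nat) (d_ge1 : (1 <= d)%N)
    (p_le_d : (p <= d)%N) (f : colombeau R d) :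
  (forall A : 'M[R]_d,
     Opq R d p A -> comp_mx f (map_mx (@Rtilde_cst R) A) = f) <->
  (forall A : 'M[Rtilde_c R]_d,
     Opq (Rtilde_c R) d p A -> comp_mx f A = f).
Proof.
split=> [invf A AB|invf A AB]; last exact/invf/Opq_cst.
have mf := moderate_rep f; have [sf _] := mf.
have sp (B : epsI R -> 'M[R]_d) e : smooth (net_pullback B (colombeau_rep f) e).
  exact: smooth_pullback.
have inv_real (B : 'M[R]_d) : Opq R d p B ->
    negligible (fun e => pullback B (colombeau_rep f e) - colombeau_rep f e).
  (* [comp_mx] uses a representative of the constant matrix [B] which is only
     negligibly close to the constant net. *)
  move=> /invf/comp_mx_eqP.
  apply: (@negligible_close _ _ _ (net_pullback (fun=> B) (colombeau_rep f))) => //.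
  move=> K s b cK; apply: pullback_close => //.
  - by exists `|B|, 1; split.
  - exact: mx_net_bounded.
  - move=> b'; apply: bigO_le (mx_net_cst B b') => e.
    by rewrite distrC.
have [A' [bA' closeA' [e0 [e00 GA']]]] := exact_representative AB.
apply/comp_mx_eqP.
apply: (@negligible_close _ _ _ _ (net_pullback A' (colombeau_rep f))) => //.
  move=> K s b cK; apply: pullback_close => //; exact: mx_net_bounded.
apply/negligibleP; split=> [e|K s b cK]; first exact: smoothB.
have [M [e1 [e10 HM]]] := bA'.
have := compact_uniformity sf inv_real s b cK M.
have e20 : 0 < Num.min e0 e1 by rewrite lt_min e00.
move=> H; apply: (uniformO_eventually e20).
apply: (uniformO_reindex (h := fun e x => (A' e, x)) _ H) => e x [/=].
by rewrite lt_min => /andP[/GA' ? /HM ?].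
Qed.
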